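(* Let $(X,\mathcal{B},\mu,T)$ be an invertible measure preserving system and let $(n_j)_{j\in\mathbb{N}}$ be a sequence of natural numbers with rational spectrum. Then for any increasing Følner sequence $\Phi=(\Phi_N)_{N\in\mathbb{N}}$, we have $$\lim_{N\to\infty}\mathbb{E}_{n\in\mathrm{IP}_{\Phi_N}((n_j)_{j\in\mathbb{N}})}T^n=\sum_{t\in\sigma((n_j)_{j\in\mathbb{N}})}\omega_\Phi(t)\cdot P_t$$ in the strong operator topology on $L^2(\mu)$.
   Context: $\mathbb{N}=\{1,2,3,\dots\}$; $\mathcal{S}^1$ is the unit circle in $\mathbb{C}$. An invertible measure preserving system $(X,\mathcal{B},\mu,T)$ consists of a probability space and an invertible measurable measure preserving $T:X\to X$; throughout, $X$ is a compact metric space, $\mathcal{B}$ its Borel $\sigma$-algebra and $\mu$ a regular measure. $T$ also denotes the unitary operator $f\mapsto f\circ T$ on $L^2(\mu)$. For $t\in\mathcal{S}^1$, $P_t:L^2(\mu)\to L^2(\mu)$ is the orthogonal projection onto the $t$-eigenspace $\{f\in L^2(\mu):Tf=t f\}$. An increasing Følner sequence is a sequence $\Phi_N=\{M,M+1,\dots,a_N\}$ with $M\in\mathbb{N}$ fixed and $a_N\to\infty$. For finite $F\subseteq\mathbb{N}$ put $n_F=\sum_{j\in F}n_j$ ($n_\emptyset=0$). $\mathrm{IP}_{\Phi_N}((n_j)_{j\in\mathbb{N}})$ is the multiset $\{n_F:F\subseteq\Phi_N\}$, and averages over it count multiplicity: $\mathbb{E}_{n\in\mathrm{IP}_{\Phi_N}((n_j)_{j\in\mathbb{N}})}a_n=2^{-|\Phi_N|}\sum_{F\subseteq\Phi_N}a_{n_F}$.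 The spectrum $\sigma((n_j)_{j\in\mathbb{N}})$ is the subgroup of $\mathcal{S}^1$ generated by the complement (in $\mathcal{S}^1$) of $\bigcap_{m\in\mathbb{N}}\left\{\alpha\in\mathcal{S}^1:\lim_{d\to\infty}\prod_{j=m}^d\frac{1+\alpha^{n_j}}{2}=0\right\}$. The sequence has rational spectrum if $\sigma((n_j)_{j\in\mathbb{N}})\subseteq e^{2\pi i\mathbb{Q}}$. For $t\in e^{2\pi i\mathbb{Q}}$, $\omega_\Phi(t)=\lim_{N\to\infty}\prod_{j\in\Phi_N}\frac{1+t^{n_j}}{2}$ (this limit exists for such $t$ and increasing $\Phi$). *)

(* Defs.v *)
From HB Require Import structures.
From mathcomp Require Import all_boot all_order all_algebra.
From mathcomp Require Import finmap.
From mathcomp Require Import all_classical all_reals all_analysis.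
From mathcomp Require Import measurable_realfun complex summability.

Set Implicit Arguments.
Unset Strict Implicit.
Unset Printing Implicit Defensive.

Import Order.TTheory GRing.Theory Num.Theory numFieldNormedType.Exports.
Import Normc.

Local Open Scope classical_set_scope.
Local Open Scope ring_scope.
Local Open Scope complex_scope.

(* The library only puts the topology of C on the alias R[i]^o. *)
HB.instance Definition _ (R : realType) := NormedModule.copy R[i] R[i]^o.

HB.mixin Record hasBorelSigmaAlgebra d (R : realType) X
    & Metric R X & Measurable d X := {
  measurable_borelE : @measurable d X = <<s @open X >> }.

#[short(type="borelMetricType")]
HB.structure Definition BorelMetric d (R : realType) :=
  {X of Metric R X & Measurable d X & hasBorelSigmaAlgebra d R X}.

Definition regular_measure d (R : realType) (X : borelMetricType d R)
    (mu : {measure set X -> \bar R}) : Prop :=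
  forall A : set X, measurable A ->
    mu A = ereal_inf [set mu U | U in [set U | open U /\ A `<=` U]] /\
    mu A = ereal_sup [set mu K | K in [set K | compact K /\ K `<=` A]].

Section complex_L2.
Context d (T : measurableType d) (R : realType).
Variable mu : {measure set T -> \bar R}.
Implicit Types f g : T -> R[i].

Definition cmeasurable f : Prop :=
  measurable_fun [set: T] (@complex.Re R \o f) /\ measurable_fun [set: T] (@complex.Im R \o f).

Definition cLnorm2 f : \bar R := 'N[mu]_(2%:E)[EFin \o (@normc R \o f)]%E.

Definition square_integrable : {pred T -> R[i]} :=
  [pred f | `[< cmeasurable f /\ (cLnorm2 f < +oo)%E >]].

Lemma cmeasurable_normc f : cmeasurable f ->
  measurable_fun [set: T] (@normc R \o f).
Proof.
move=> [mr mi].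
have -> : @normc R \o f =
    @Num.sqrt R \o (fun x => (complex.Re (f x)) ^+ 2 + (complex.Im (f x)) ^+ 2).
  by apply/funext => x /=; case: (f x).
apply: measurableT_comp.
  by apply: continuous_measurable_fun; exact: sqrt_continuous.
by apply: measurable_funD; exact: measurable_funX.
Qed.

Lemma cmeasurableD f g : cmeasurable f -> cmeasurable g -> cmeasurable (f + g).
Proof.
move=> [fr fi] [gr gi]; split.
  have -> : @complex.Re R \o (f + g) = (@complex.Re R \o f) \+ (@complex.Re R \o g).
    by apply/funext => x; rewrite /= fctE; case: (f x); case: (g x).
  exact: measurable_funD.
have -> : @complex.Im R \o (f + g) = (@complex.Im R \o f) \+ (@complex.Im R \o g).
  by apply/funext => x; rewrite /= fctE; case: (f x); case: (g x).
exact: measurable_funD.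
Qed.

Lemma cmeasurableZ (a : R[i]) f : cmeasurable f -> cmeasurable (a *: f).
Proof.
case: a => a b [fr fi]; split.
  have -> : @complex.Re R \o ((a +i* b) *: f) =
      (fun x => a * complex.Re (f x)) \- (fun x => b * complex.Im (f x)).
    by apply/funext => x; rewrite /= fctE; case: (f x).
  by apply: measurable_funB; exact: measurable_funM.
have -> : @complex.Im R \o ((a +i* b) *: f) =
    (fun x => a * complex.Im (f x)) \+ (fun x => b * complex.Re (f x)).
  by apply/funext => x; rewrite /= fctE; case: (f x).
by apply: measurable_funD; exact: measurable_funM.
Qed.

Lemma normc_ge0 (z : R[i]) : 0 <= normc z.
Proof. by case: z => a b; exact: sqrtr_ge0. Qed.

Lemma cLnorm2E f : cLnorm2 f = ((\int[mu]_x ((normc (f x)) `^ 2)%:E) `^ 2^-1)%E.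
Proof.
rewrite /cLnorm2 unlock /Lnorm; congr (_ `^ _)%E.
by apply: eq_integral => x _ /=; rewrite ger0_norm ?normc_ge0.
Qed.

Lemma le_cLnorm2D f g : cmeasurable f -> cmeasurable g ->
  (cLnorm2 (f + g)%R <= cLnorm2 f + cLnorm2 g)%E.
Proof.
move=> mf mg.
have mnf := cmeasurable_normc mf; have mng := cmeasurable_normc mg.
apply: (@le_trans _ _
  ('N[mu]_(2%:E)[EFin \o ((@normc R \o f) \+ (@normc R \o g))%R])%E); last first.
  by apply: eminkowski => //; rewrite lee_fin ler1n.
rewrite /cLnorm2 unlock /Lnorm.
have ge0 (h : T -> R) : (0 <= \int[mu]_x (`|(h x)%:E| `^ 2))%E.
  by apply: integral_ge0 => x _; exact: poweR_ge0.
apply: gt0_ler_poweR; rewrite ?invr_ge0 ?ler0n// ?in_itv/= ?leey ?ge0//.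
apply: ge0_le_integral => //.
- apply/measurable_EFinP/(measurableT_comp (measurable_powR _)) => //.
  by apply: measurableT_comp => //; exact/cmeasurable_normc/cmeasurableD.
- apply/measurable_EFinP/(measurableT_comp (measurable_powR _)) => //.
  by apply: measurableT_comp => //; exact: measurable_funD.
move=> x _ /=; rewrite lee_fin ge0_ler_powR ?nnegrE//.
rewrite !ger0_norm ?addr_ge0 ?normc_ge0//.
exact: le_normcD.
Qed.

Lemma cLnorm2Z (a : R[i]) f : cmeasurable f ->
  (cLnorm2 (a *: f)%R = (normc a)%:E * cLnorm2 f)%E.
Proof.
move=> mf; have mnf := cmeasurable_normc mf.
rewrite !cLnorm2E.
have -> : (\int[mu]_x ((normc ((a *: f)%R x)) `^ 2)%:E =
    ((normc a) `^ 2)%:E * \int[mu]_x ((normc (f x)) `^ 2)%:E)%E.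
  rewrite -ge0_integralZl//.
  - apply: eq_integral => x _ /=.
    by rewrite fctE normcM powRM ?normc_ge0// EFinM.
  - apply/measurable_EFinP.
    exact: (measurableT_comp (measurable_powR _)).
  - by move=> x _; rewrite lee_fin powR_ge0.
  - by rewrite lee_fin powR_ge0.
rewrite poweRM ?integral_ge0 ?lee_fin ?powR_ge0//; last first.
  by move=> x _; rewrite lee_fin powR_ge0.
by rewrite poweR_EFin -powRrM mulfV// powRr1 ?normc_ge0.
Qed.

Lemma cLnorm2_0 : cLnorm2 0 = 0%E.
Proof.
rewrite /cLnorm2 (_ : EFin \o _ = cst 0%E) ?Lnorm0//.
by apply/funext => x /=; rewrite expr0n/= addr0 sqrtr0.
Qed.

Lemma cLnorm2_ge0 f : (0 <= cLnorm2 f)%E.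
Proof. exact: Lnorm_ge0. Qed.

Lemma square_integrable_submod_closed : submod_closed square_integrable.
Proof.
split.
  apply/asboolP; split; last by rewrite cLnorm2_0.
  by split; exact: measurable_cst.
move=> a f g /asboolP[mf lf] /asboolP[mg lg]; apply/asboolP.
have maf := cmeasurableZ a mf; split; first exact: cmeasurableD.
rewrite (le_lt_trans (le_cLnorm2D maf mg))// cLnorm2Z//.
rewrite lte_add_pinfty// lte_mul_pinfty// ?lee_fin ?normc_ge0//.
Qed.

HB.instance Definition _ :=
  GRing.isSubmodClosed.Build R[i] (T -> R[i]) square_integrable
    square_integrable_submod_closed.

Record L2fun := mkL2fun
  { L2fun_val :> T -> R[i]; _ : L2fun_val \in square_integrable }.
HB.instance Definition _ := [isSub for L2fun_val].
HB.instance Definition _ := [Choice of L2fun by <:].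
HB.instance Definition _ := [SubChoice_isSubLmodule of L2fun by <:].

Lemma L2funP (f : L2fun) : cmeasurable f /\ (cLnorm2 f < +oo)%E.
Proof. by case: f => f /= /asboolP. Qed.

Definition ae_null : {pred L2fun} :=
  [pred f : L2fun | `[< {ae mu, forall x, f x = 0} >]].

Lemma ae_null_zmod_closed : zmod_closed ae_null.
Proof.
split; first by apply/asboolP; apply: nearW.
move=> f g /asboolP f0 /asboolP g0; apply/asboolP.
by apply: filterS2 f0 g0 => x fx gx; rewrite -[LHS]/(f x - g x) fx gx subrr.
Qed.

HB.instance Definition _ :=
  GRing.isZmodClosed.Build L2fun ae_null ae_null_zmod_closed.

Definition L2 : Type := Quotient.quot ae_null.
HB.instance Definition _ := GRing.Zmodule.on L2.
HB.instance Definition _ := EqQuotient.on L2.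

Local Open Scope quotient_scope.

Definition to_L2 (f : L2fun) : L2 := \pi_L2 f.
Definition of_L2 (f : L2) : L2fun := repr f.

Lemma of_L2K : cancel of_L2 to_L2.
Proof. exact: reprK. Qed.

Lemma to_L2P (f g : L2fun) :
  to_L2 f = to_L2 g <-> {ae mu, forall x, f x = g x}.
Proof.
have P : (f == g %[mod L2]) = `[< {ae mu, forall x, (f - g) x = 0} >].
  by rewrite -Quotient.idealrBE.
split=> [/eqP|fg].
  rewrite /to_L2 P => /asboolP; apply: filterS => x.
  by rewrite -[X in X -> _]/(f x - g x = 0) => /eqP; rewrite subr_eq0 => /eqP.
apply/eqP; rewrite /to_L2 P; apply/asboolP; apply: filterS fg => x fg.
by rewrite -[LHS]/(f x - g x) fg subrr.
Qed.

Lemma to_L2K (f : L2fun) : {ae mu, forall x, of_L2 (to_L2 f) x = f x}.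
Proof. by apply/to_L2P; rewrite of_L2K. Qed.

Lemma to_L2D (f g : L2fun) : to_L2 (f + g) = to_L2 f + to_L2 g.
Proof. by rewrite /to_L2 raddfD. Qed.

Lemma of_L2D (f g : L2) :
  {ae mu, forall x, of_L2 (f + g) x = of_L2 f x + of_L2 g x}.
Proof.
have := to_L2K (of_L2 f + of_L2 g).
by rewrite to_L2D !of_L2K; apply: filterS => x ->.
Qed.

Definition L2_scale (a : R[i]) (f : L2) : L2 := to_L2 (a *: of_L2 f).

Lemma to_L2Z (a : R[i]) (f : L2fun) : to_L2 (a *: f) = L2_scale a (to_L2 f).
Proof.
apply/esym/to_L2P; apply: filterS (to_L2K f) => x fx.
by rewrite -[RHS]/(a *: f x) -fx.
Qed.

Lemma L2_scaleA (a b : R[i]) (f : L2) :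
  L2_scale a (L2_scale b f) = L2_scale (a * b) f.
Proof. by rewrite -[f]of_L2K -!to_L2Z scalerA. Qed.

Lemma L2_scale1 : left_id 1 L2_scale.
Proof. by move=> f; rewrite -[f]of_L2K -to_L2Z scale1r. Qed.

Lemma L2_scaleDr : right_distributive L2_scale +%R.
Proof.
move=> a f g; rewrite -[f]of_L2K -[g]of_L2K.
by rewrite -to_L2D -!to_L2Z -to_L2D scalerDr.
Qed.

Lemma L2_scaleDl (f : L2) : {morph L2_scale^~ f : a b / a + b}.
Proof. by move=> a b; rewrite -[f]of_L2K -!to_L2Z -to_L2D scalerDl. Qed.

HB.instance Definition _ := GRing.Zmodule_isLmodule.Build R[i] L2
  L2_scaleA L2_scale1 L2_scaleDr L2_scaleDl.

(* R[i]-valued because the norm of a normedModType lives in its scalar field *)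
Definition L2_norm (f : L2) : R[i] := (fine (cLnorm2 (of_L2 f)))%:C.

Lemma ae_cLnorm2 f g : cmeasurable f -> cmeasurable g ->
  {ae mu, forall x, f x = g x} -> cLnorm2 f = cLnorm2 g.
Proof.
move=> mf mg fg; rewrite !cLnorm2E; congr (_ `^ _)%E.
apply: ge0_ae_eq_integral => //.
- apply/measurable_EFinP; apply: (measurableT_comp (measurable_powR _)) => //.
  exact: cmeasurable_normc.
- apply/measurable_EFinP; apply: (measurableT_comp (measurable_powR _)) => //.
  exact: cmeasurable_normc.
- by move=> x _; rewrite lee_fin powR_ge0.
- by move=> x _; rewrite lee_fin powR_ge0.
- by apply: filterS fg => x -> _.
Qed.

Lemma L2fun_fineK (f : L2fun) : (fine (cLnorm2 f))%:E = cLnorm2 f.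
Proof. by rewrite fineK// ge0_fin_numE ?cLnorm2_ge0//; case: (L2funP f). Qed.

Lemma L2_norm_to_L2 (f : L2fun) : L2_norm (to_L2 f) = (fine (cLnorm2 f))%:C.
Proof.
have [[mf _] [mf' _]] := (L2funP f, L2funP (of_L2 (to_L2 f))).
by rewrite /L2_norm (ae_cLnorm2 mf' mf (to_L2K f)).
Qed.

Lemma ler_L2_normD (f g : L2) : L2_norm (f + g) <= L2_norm f + L2_norm g.
Proof.
rewrite -[f]of_L2K -[g]of_L2K -to_L2D !L2_norm_to_L2 -rmorphD/= lecR.
rewrite -lee_fin EFinD !L2fun_fineK.
have [[mf _] [mg _]] := (L2funP (of_L2 f), L2funP (of_L2 g)).
by rewrite (L2fun_fineK (of_L2 f + of_L2 g)); exact: le_cLnorm2D mf mg.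
Qed.

Lemma L2_normZ (a : R[i]) (f : L2) : L2_norm (a *: f) = `|a| * L2_norm f.
Proof.
have -> : a *: f = to_L2 (a *: of_L2 f) by [].
rewrite L2_norm_to_L2 cLnorm2Z; last by case: (L2funP (of_L2 f)).
by rewrite -L2fun_fineK -EFinM /= rmorphM.
Qed.

Lemma L2_norm_eq0 (f : L2) : L2_norm f = 0 -> f = 0.
Proof.
move=> /(congr1 (@complex.Re R)) /= f0.
have [mf _] := L2funP (of_L2 f).
have : cLnorm2 (of_L2 f) = 0%E by rewrite -L2fun_fineK f0.
move/Lnorm_eq0_eq0; rewrite lte_fin ltr0n => /(_ _ isT) nf.
have {}nf : {ae mu, forall x, of_L2 f x = 0}.
  have /nf : measurable_fun [set: T] (EFin \o (@normc R \o of_L2 f)).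
    by apply/measurable_EFinP; exact: cmeasurable_normc.
  by apply: filterS => x /(_ I)[] /eq0_normc.
rewrite -[f]of_L2K -[RHS]of_L2K; apply/to_L2P.
have z : {ae mu, forall x, of_L2 0 x = 0 :> R[i]}.
  have := to_L2K 0; rewrite /to_L2 raddf0; apply: filterS => x ->.
  by [].
by apply: filterS2 nf z => x -> ->.
Qed.

HB.instance Definition _ := Lmodule_isNormed.Build R[i] L2
  ler_L2_normD L2_normZ L2_norm_eq0.

Definition cintegral (f : T -> R[i]) : R[i] :=
  Rintegral mu [set: T] (@complex.Re R \o f) +i* Rintegral mu [set: T] (@complex.Im R \o f).

Definition L2_inner (f g : L2) : R[i] :=
  cintegral (fun x => of_L2 f x * (of_L2 g x)^*).

(* the junk value 0 occurs only if f has no orthogonal projection on V *)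
Definition orth_proj (V : set L2) (f : L2) : L2 :=
  xget 0 [set g | V g /\ forall h, V h -> L2_inner (f - g) h = 0].

End complex_L2.

Record invertible_mpt d (X : measurableType d) (R : realType)
    (mu : {measure set X -> \bar R}) := InvertibleMpt {
  mpt_fun :> X -> X ;
  mpt_inv : X -> X ;
  mpt_funK : cancel mpt_fun mpt_inv ;
  mpt_invK : cancel mpt_inv mpt_fun ;
  measurable_mpt_fun : measurable_fun [set: X] mpt_fun ;
  measurable_mpt_inv : measurable_fun [set: X] mpt_inv ;
  mpt_preserving : forall A, measurable A -> mu (mpt_fun @^-1` A) = mu A
}.

Section koopman.
Context d (X : measurableType d) (R : realType).
Variables (mu : {measure set X -> \bar R}) (T : invertible_mpt mu).

Lemma square_integrable_mpt (f : L2fun mu) :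
  (f : X -> R[i]) \o T \in square_integrable mu.
Proof.
have [[mr mi] lf] := L2funP f; have mT := measurable_mpt_fun T.
apply/asboolP; split.
  by split; [exact: (measurableT_comp mr mT)|exact: (measurableT_comp mi mT)].
suff -> : cLnorm2 mu ((f : X -> R[i]) \o T) = cLnorm2 mu f by [].
rewrite !cLnorm2E; congr (_ `^ _)%E.
have m2 : measurable_fun [set: X] (fun x => ((normc (f x)) `^ 2)%:E).
  apply/measurable_EFinP/(measurableT_comp (measurable_powR _)) => //.
  exact: cmeasurable_normc.
have := ge0_integral_pushforward mT mu measurableT m2.
rewrite preimage_setT => <-; last by move=> x _; rewrite lee_fin powR_ge0.
by apply: eq_measure_integral => A mA _; exact: (mpt_preserving T mA).
Qed.

Definition koopman (f : L2 mu) : L2 mu :=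
  to_L2 (mkL2fun (square_integrable_mpt (of_L2 f))).

Definition eigenspace (t : R[i]) : set (L2 mu) := [set f | koopman f = t *: f].

Definition eigen_proj (t : R[i]) : L2 mu -> L2 mu := orth_proj (eigenspace t).

End koopman.

(* Sequences (n_j) indexed by j >= 1 are functions on nat whose value at 0 is
   never used. *)
Section spectrum.
Variable R : realType.
Implicit Types (n : nat -> nat) (t : R[i]).

Definition unit_circle : set R[i] := [set z | `|z| = 1].

Definition circle_subgroup (G : set R[i]) : Prop :=
  [/\ G `<=` unit_circle, G 1, (forall x y, G x -> G y -> G (x * y))
    & forall x, G x -> G x^-1].

Definition vanishing_products n : set R[i] :=
  \bigcap_(m in [set m | (0 < m)%N]) [set t | unit_circle t /\
    \prod_(m <= j < d.+1) ((1 + t ^+ n j) / 2) @[d --> \oo] --> (0 : R[i])].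

Definition spectrum n : set R[i] :=
  smallest circle_subgroup (unit_circle `\` vanishing_products n).

Definition rational_circle : set R[i] :=
  [set cos (2 * pi * ratr q) +i* sin (2 * pi * ratr q) | q in [set: rat]].

Definition rational_spectrum n : Prop := spectrum n `<=` rational_circle.

Definition increasing_folner (Phi : nat -> {fset nat}) : Prop :=
  exists (M : nat) (a : nat -> nat), [/\ (0 < M)%N, a @ \oo --> \oo
    & forall N j, (j \in Phi N) = (M <= j <= a N)%N].

Definition omega n (Phi : nat -> {fset nat}) t : R[i] :=
  lim (\prod_(j <- Phi N) ((1 + t ^+ n j) / 2) @[N --> \oo]).

Definition ip_sum n (F : {fset nat}) : nat := (\sum_(j <- F) n j)%N.

Definition ip_avg (V : lmodType R[i]) n (Phi : {fset nat}) (a : nat -> V) : V :=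
  (2 ^+ #|` Phi|)^-1 *: \sum_(F <- fpowerset Phi) a (ip_sum n F).

End spectrum.

Arguments spectrum R n : clear implicits.

(* Main.v *)
(* The averages are q_d(U), where U is the Koopman operator and q_d the product of
   the polynomials (1 + X^(n j)) / 2. The spectral theorem is avoided: a pointwise
   bound |q|^2 <= sum c_i |p_i|^2 on the unit circle implies the corresponding
   bound for the norms of q(U) f and p_i(U) f, by Parseval on a large cyclic group
   applied to a long piece of the orbit of f. Off the countable spectrum q_d tends
   to 0, while near a point t of the spectrum |q_d|^2 <= 1 is at most twice the
   square of the ergodic polynomial K of t, and K(U) f is close to P_t f by the mean
   ergodic theorem. By compactness of the circle, ||q_d(U) f'||^2 is therefore
   eventually at most a small error plus a multiple of the sum of the ||P_t f'||^2.
   Removing from f finitely many projections P_t f makes this sum small (Bessel),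
   and on the removed part q_d(U) acts by the scalars q_d(t), which converge to
   omega(t) since t is a root of unity. *)
Require Import Defs.
From HB Require Import structures.
From mathcomp Require Import all_boot all_order all_algebra.
From mathcomp Require Import finmap.
From mathcomp Require Import all_classical all_reals all_analysis.
From mathcomp Require Import measurable_realfun complex summability.
From mathcomp Require Import ring lra.

Set Implicit Arguments.
Unset Strict Implicit.
Unset Printing Implicit Defensive.

Import Order.TTheory GRing.Theory Num.Theory numFieldNormedType.Exports.
Local Open Scope classical_set_scope.
Local Open Scope ring_scope.
Import Normc.
Local Open Scope complex_scope.

(** The obstacle is the order of choices. Compactness selects the finitely many points of the
    spectrum that matter only after an ergodic polynomial K has been fixed at every point, so the
    errors in replacing K(U) f' by P_t f' must be summable over the whole spectrum. Countability
    provides this: rationality gives an injective [rank] of the spectrum into the naturals, and the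
    point of rank k is allowed the error e 2^-(k+1). Uniformity in d comes from the fact that |q_d|
    decreases with d on the circle, as in Dini's theorem: once small near a point, it stays small
    there. The factor 2 appears because K(t) = 1, hence |K|^2 > 1/2 near t. The core is proved for
    an isometry of a complete inner product space with orthogonal projections on eigenspaces. It
    yields one finite subset of the spectrum whose partial sum is close both to all later averages
    and to all larger partial sums. So the averages are Cauchy, the series converges
    unconditionally, and the two limits agree. *)

Lemma le0_of_le_pos (R : realType) (x : R) :
  (forall e : R, 0 < e -> x <= e) -> x <= 0.
Proof. by move=> xe; apply/ler_addgt0Pr => e e0; rewrite add0r xe. Qed.

(** * Complex inner product spaces with real-valued norms *)

Record inner_product (R : realType) (H : normedModType R[i])
    (ip : H -> H -> R[i]) : Prop := InnerProduct {
  ip_linear : forall a f g h, ip (a *: f + g) h = a * ip f h + ip g h ;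
  ip_conj : forall f g, ip g f = (ip f g)^*%C ;
  ip_norm : forall f, ip f f = `|f| ^+ 2
}.

Section real_norm.
Context (R : realType) (H : normedModType R[i]).
Implicit Types (f g h : H) (a z : R[i]).

Lemma normrc z : `|z| = (normc z)%:C. Proof. by []. Qed.

(* Norms of a normed module over R[i] are valued in R[i]. *)
Definition nrm f : R := complex.Re `|f|.

Lemma nrmC f : (nrm f)%:C = `|f|.
Proof. by rewrite /nrm RRe_real// normr_real. Qed.

Lemma nrm_ge0 f : 0 <= nrm f.
Proof. by rewrite -ler0c nrmC normr_ge0. Qed.

Lemma nrm0 : nrm 0 = 0.
Proof. by rewrite /nrm normr0. Qed.

Lemma nrmD f g : nrm (f + g) <= nrm f + nrm g.
Proof. by rewrite -lecR rmorphD/= !nrmC ler_normD. Qed.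

Lemma nrmN f : nrm (- f) = nrm f.
Proof. by rewrite /nrm normrN. Qed.

Lemma nrmB f g : nrm (f - g) <= nrm f + nrm g.
Proof. by rewrite (le_trans (nrmD _ _))// nrmN. Qed.

Lemma nrm_distC f g : nrm (f - g) = nrm (g - f).
Proof. by rewrite -nrmN opprB. Qed.

Lemma nrm_distD g f h : nrm (f - h) <= nrm (f - g) + nrm (g - h).
Proof. by rewrite (le_trans _ (nrmD _ _))// addrA subrK. Qed.

Lemma nrmZ a f : nrm (a *: f) = normc a * nrm f.
Proof. by apply: complexI; rewrite nrmC normrZ -nrmC normrc rmorphM. Qed.

Lemma nrm_sum (I : Type) (r : seq I) (F : I -> H) :
  nrm (\sum_(i <- r) F i) <= \sum_(i <- r) nrm (F i).
Proof.
elim: r => [|i r ih]; first by rewrite !big_nil nrm0.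
by rewrite !big_cons (le_trans (nrmD _ _))// lerD2l.
Qed.

Lemma nrm_eq0 f : nrm f = 0 -> f = 0.
Proof. by move=> /(congr1 (real_complex R)); rewrite nrmC => /normr0_eq0. Qed.

Lemma cvg_nrmP (T : Type) (F : set_system T) (FF : Filter F) (u : T -> H) l :
  (u @ F --> l) <-> (forall e : R, 0 < e -> \forall x \near F, nrm (u x - l) < e).
Proof.
split=> [/cvgrPdist_lt ul e e0|ul].
  have /ul : 0 < e%:C by rewrite ltcR.
  by apply: filterS => x; rewrite -nrmC ltcR nrm_distC.
apply/cvgrPdist_lt => e e0.
have eE : (complex.Re e)%:C = e by rewrite RRe_real// gtr0_real.
rewrite -eE ltcR in e0 *.
by apply: filterS (ul _ e0) => x; rewrite -nrmC ltcR nrm_distC.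
Qed.

End real_norm.

Section normc.
Context (R : realType).
Implicit Types z w : R[i].

Lemma normcX z n : normc (z ^+ n) = normc z ^+ n.
Proof. by apply: complexI; rewrite -normrc normrX rmorphXn. Qed.

Lemma normc_sqr z : (normc z ^+ 2)%:C = z * z^*%C.
Proof. by rewrite rmorphXn/= -normrc sqr_normc. Qed.

Lemma normc_conj z : normc z^*%C = normc z.
Proof. by apply: complexI; rewrite -!normrc normcJ. Qed.

Lemma normc_real (a : R) : normc a%:C = `|a|.
Proof. by rewrite /= expr0n addr0 sqrtr_sqr. Qed.

Lemma conjcR (a : R) : (a%:C)^*%C = a%:C.
Proof. exact: conjc_real. Qed.

Lemma normc_nat n : normc n%:R = n%:R :> R.
Proof. by rewrite -(rmorph_nat (real_complex R)) normc_real normr_nat. Qed.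

Lemma normc_prod (I : Type) (r : seq I) (F : I -> R[i]) :
  normc (\prod_(i <- r) F i) = \prod_(i <- r) normc (F i).
Proof.
elim: r => [|i r ih]; first by rewrite !big_nil normc1.
by rewrite !big_cons normcM ih.
Qed.

Lemma cvg_normcP (T : Type) (F : set_system T) (FF : Filter F) (u : T -> R[i]) l :
  (u @ F --> l) <->
  (forall e : R, 0 < e -> \forall x \near F, normc (u x - l) < e).
Proof. by split=> [/(@cvg_nrmP R R[i]^o)|h]; [|apply/(@cvg_nrmP R R[i]^o)]. Qed.

End normc.

Section inner_product.
Context (R : realType) (H : normedModType R[i]) (ip : H -> H -> R[i]).
Hypothesis ipH : inner_product ip.
Implicit Types (f g h : H) (a : R[i]).

Lemma ipDl f g h : ip (f + g) h = ip f h + ip g h.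
Proof. by rewrite -[f]scale1r (ip_linear ipH) mul1r scale1r. Qed.

Lemma ip0l f : ip 0 f = 0.
Proof. by apply: (addrI (ip 0 f)); rewrite -ipDl !addr0. Qed.

Lemma ipZl a f h : ip (a *: f) h = a * ip f h.
Proof. by rewrite -[a *: f]addr0 (ip_linear ipH) ip0l addr0. Qed.

Lemma ipNl f h : ip (- f) h = - ip f h.
Proof. by rewrite -scaleN1r ipZl mulN1r. Qed.

Lemma ipBl f g h : ip (f - g) h = ip f h - ip g h.
Proof. by rewrite ipDl ipNl. Qed.

Lemma ipDr f g h : ip h (f + g) = ip h f + ip h g.
Proof. by rewrite (ip_conj ipH) ipDl rmorphD/= -!(ip_conj ipH). Qed.

Lemma ip0r f : ip f 0 = 0.
Proof. by rewrite (ip_conj ipH) ip0l conjc0. Qed.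

Lemma ipZr a f h : ip h (a *: f) = a^*%C * ip h f.
Proof. by rewrite (ip_conj ipH) ipZl rmorphM/= -(ip_conj ipH). Qed.

Lemma ipBr f g h : ip h (f - g) = ip h f - ip h g.
Proof. by rewrite (ip_conj ipH) ipBl rmorphB/= -!(ip_conj ipH). Qed.

Lemma ipNr f h : ip h (- f) = - ip h f.
Proof. by rewrite -[- f]add0r ipBr ip0r add0r. Qed.

Lemma ip_suml (I : Type) (r : seq I) (P : pred I) (F : I -> H) h :
  ip (\sum_(i <- r | P i) F i) h = \sum_(i <- r | P i) ip (F i) h.
Proof. by elim/big_rec2: _ => [|i x y _ <-]; rewrite ?ip0l ?ipDl. Qed.

Lemma ip_sumr (I : Type) (r : seq I) (P : pred I) (F : I -> H) h :
  ip h (\sum_(i <- r | P i) F i) = \sum_(i <- r | P i) ip h (F i).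
Proof. by elim/big_rec2: _ => [|i x y _ <-]; rewrite ?ip0r ?ipDr. Qed.

Lemma ip_nrm f : ip f f = (nrm f ^+ 2)%:C.
Proof. by rewrite (ip_norm ipH) rmorphXn/= nrmC. Qed.

Lemma nrm_sqD f g :
  nrm (f + g) ^+ 2 = nrm f ^+ 2 + nrm g ^+ 2 + 2 * complex.Re (ip f g).
Proof.
apply: complexI; rewrite -ip_nrm ipDl !ipDr !ip_nrm (ip_conj ipH f g).
rewrite !rmorphD/= !rmorphM/= rmorph_nat -addcJ; ring.
Qed.

Lemma parallelogram f g :
  nrm (f + g) ^+ 2 + nrm (f - g) ^+ 2 = 2 * nrm f ^+ 2 + 2 * nrm g ^+ 2.
Proof.
rewrite !nrm_sqD nrmN ipNr raddfN/=; ring.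
Qed.

(** The vector [(nrm g ^+ 2)%:C *: f - ip f g *: g], a multiple of the part of [f] orthogonal to
    [g], has squared norm [nrm g ^+ 2] times [nrm g ^+ 2 * nrm f ^+ 2 - normc (ip f g) ^+ 2]. *)
Lemma cauchy_schwarz f g : normc (ip f g) <= nrm f * nrm g.
Proof.
have [g0|g0] := eqVneq (nrm g) 0.
  by rewrite (nrm_eq0 g0) ip0r nrm0 mulr0 normc0.
have gp : 0 < nrm g by rewrite lt_def g0 nrm_ge0.
have /(congr1 (@complex.Re R)) := ip_nrm ((nrm g ^+ 2)%:C *: f - ip f g *: g).
rewrite ipBl !ipBr !ipZl !ipZr !ip_nrm conjcR (ip_conj ipH f g).
have -> : (nrm g ^+ 2)%:C * ((nrm g ^+ 2)%:C * (nrm f ^+ 2)%:C) -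
    (nrm g ^+ 2)%:C * ((ip f g)^*%C * ip f g) -
    (ip f g * ((nrm g ^+ 2)%:C * (ip f g)^*%C) -
     ip f g * ((ip f g)^*%C * (nrm g ^+ 2)%:C)) =
   (nrm g ^+ 2 * (nrm g ^+ 2 * nrm f ^+ 2 - normc (ip f g) ^+ 2))%:C.
  by rewrite !(rmorphM, rmorphB)/= -!rmorphM/= normc_sqr !rmorphM/=; ring.
move=> /= sqE.
have := sqr_ge0 (nrm ((nrm g ^+ 2)%:C *: f - ip f g *: g)).
rewrite -sqE pmulr_rge0 ?exprn_gt0// subr_ge0 -exprMn => le.
by rewrite -ler_sqr ?nnegrE ?mulr_ge0 ?nrm_ge0 ?Defs.normc_ge0// mulrC.
Qed.

Lemma pythagoras (I : eqType) (r : seq I) (F : I -> H) : uniq r ->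
  {in r &, forall i j, i != j -> ip (F i) (F j) = 0} ->
  nrm (\sum_(i <- r) F i) ^+ 2 = \sum_(i <- r) nrm (F i) ^+ 2.
Proof.
elim: r => [|i r ih] /=; first by rewrite !big_nil nrm0 expr0n.
move=> /andP[ir ur] orth; rewrite !big_cons nrm_sqD ih//; last first.
  by move=> j k jr kr; apply: orth; rewrite inE ?jr ?kr orbT.
suff -> : ip (F i) (\sum_(j <- r) F j) = 0 by rewrite mulr0 addr0.
rewrite ip_sumr big_seq big1// => j jr.
by apply: orth; rewrite ?inE ?eqxx ?jr ?orbT//; apply: contraNneq ir => ->.
Qed.

End inner_product.

(** * Polynomials in a linear operator *)

Section polynomial_action.
Context (R : realType) (H : normedModType R[i]) (U : {linear H -> H}).
Implicit Types (f g : H) (p q : {poly R[i]}) (t : R[i]).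

Lemma iterZD n a f g : iter n U (a *: f + g) = a *: iter n U f + iter n U g.
Proof. by elim: n => //= n ->; rewrite linearP. Qed.

Definition act p f : H := \sum_(i < size p) p`_i *: iter i U f.

Lemma act_wide n p f : (size p <= n)%N ->
  act p f = \sum_(i < n) p`_i *: iter i U f.
Proof.
move=> pn; rewrite /act (big_ord_widen n (fun i => p`_i *: iter i U f) pn).
rewrite big_mkcond/=; apply: eq_bigr => i _; case: ltnP => // ip.
by rewrite nth_default// scale0r.
Qed.

Fact act_linear p : linear (act p).
Proof.
move=> a f g; rewrite /act scaler_sumr -big_split/=; apply: eq_bigr => i _.
by rewrite iterZD scalerDr !scalerA mulrC.
Qed.

HB.instance Definition _ p :=
  GRing.isLinear.Build R[i] H H *:%R (act p) (act_linear p).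

Lemma actZDl a p q f : act (a *: p + q) f = a *: act p f + act q f.
Proof.
pose n := maxn (size p) (size q).
rewrite (@act_wide n (a *: p + q)); last first.
  rewrite (leq_trans (size_polyD _ _))// geq_max leq_maxr andbT.
  by rewrite (leq_trans (size_scale_leq _ _))// leq_maxl.
rewrite (@act_wide n p) ?leq_maxl// (@act_wide n q) ?leq_maxr//.
rewrite scaler_sumr -big_split/=; apply: eq_bigr => i _.
by rewrite coefD coefZ scalerDl scalerA.
Qed.

Lemma act0p f : act 0 f = 0.
Proof. by rewrite /act size_poly0 big_ord0. Qed.

Lemma actDl p q f : act (p + q) f = act p f + act q f.
Proof. by rewrite -[p]scale1r actZDl !scale1r. Qed.

Lemma actZl a p f : act (a *: p) f = a *: act p f.
Proof. by rewrite -[a *: p]addr0 actZDl act0p addr0. Qed.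

Lemma actBl p q f : act (p - q) f = act p f - act q f.
Proof. by rewrite -scaleN1r addrC actZDl scaleN1r addrC. Qed.

Lemma act_suml (I : Type) (r : seq I) (F : I -> {poly R[i]}) f :
  act (\sum_(i <- r) F i) f = \sum_(i <- r) act (F i) f.
Proof. by elim/big_rec2: _ => [|i x y _ <-]; rewrite ?act0p ?actDl. Qed.

Lemma actC a f : act a%:P f = a *: f.
Proof.
rewrite (@act_wide 1) ?size_polyC ?leq_b1// big_ord_recl big_ord0/=.
by rewrite coefC/= addr0.
Qed.

Lemma act1 f : act 1 f = f.
Proof. by rewrite actC scale1r. Qed.

Lemma actMX p f : act (p * 'X) f = U (act p f).
Proof.
rewrite (@act_wide (size p).+1); last first.
  by rewrite (leq_trans (size_polyMleq _ _))// size_polyX addn2.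
rewrite big_ord_recl coefMX/= scale0r add0r /act linear_sum/=.
by apply: eq_bigr => i _; rewrite coefMX/= linearZ.
Qed.

Lemma actM p q f : act (p * q) f = act p (act q f).
Proof.
elim/poly_ind: p => [|p c ih]; first by rewrite mul0r !act0p.
rewrite mulrDl -mulrA [_ * q]mulrC mulrA actDl actMX ih -mulrC -actMX.
by rewrite mulrC mul_polyC actZl -[c *: act q f]actC -actDl.
Qed.

Lemma act_comm p q f : act p (act q f) = act q (act p f).
Proof. by rewrite -!actM mulrC. Qed.

Lemma actX f : act 'X f = U f.
Proof. by rewrite -[X in act X]mul1r actMX act1. Qed.

Lemma actXn n f : act 'X^n f = iter n U f.
Proof. by elim: n => [|n ih]; rewrite ?expr0 ?act1// exprS actM actX ih. Qed.

Lemma act_eigen p f t : U f = t *: f -> act p f = p.[t] *: f.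
Proof.
move=> Uf; elim/poly_ind: p => [|p c ih]; first by rewrite act0p horner0 scale0r.
by rewrite actDl actMX ih linearZ/= Uf actC hornerMXaddC scalerDl scalerA.
Qed.

Hypothesis isoU : forall f, nrm (U f) = nrm f.

Lemma nrm_iter n f : nrm (iter n U f) = nrm f.
Proof. by elim: n => //= n ih; rewrite isoU. Qed.

End polynomial_action.

Definition sequentially_complete (R : realType) (H : normedModType R[i]) :=
  forall u : nat -> H,
  (forall e : R, 0 < e -> exists N, forall m n, (N <= m)%N -> (N <= n)%N ->
     nrm (u m - u n) < e) ->
  exists l : H, u @ \oo --> l.

(** * The mean ergodic theorem for the rotated isometry [t^-1 U] *)

Section mean_ergodic.
Context (R : realType) (H : normedModType R[i]) (ip : H -> H -> R[i]).
Context (U : {linear H -> H}) (t : R[i]).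
Hypotheses (ipH : inner_product ip) (complH : sequentially_complete H).
Hypotheses (isoU : forall f g, ip (U f) (U g) = ip f g) (t1 : normc t = 1).
Implicit Types (f g h : H).

Lemma iso_nrm f : nrm (U f) = nrm f.
Proof.
apply/eqP; rewrite -(@eqrXn2 _ 2)// ?nrm_ge0//; apply/eqP/complexI.
by rewrite -!(ip_nrm ipH) isoU.
Qed.

Let Y : {poly R[i]} := t^-1 *: 'X.

(** The ergodic polynomial of [t]: it acts as the Cesàro mean of the powers of [t^-1 U], whose fixed
    vectors are the [t]-eigenvectors of [U]. *)
Definition twisted_avg n : {poly R[i]} :=
  n.+1%:R^-1 *: \sum_(i < n.+1) (t^-1 *: 'X) ^+ i.

Local Notation K := twisted_avg.

Lemma unit_circle_neq0 : t != 0.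
Proof. by apply: contra_eq_neq t1 => ->; rewrite normc0 eq_sym oner_eq0. Qed.

Lemma nrm_act_twist n f : nrm (act U (Y ^+ n) f) = nrm f.
Proof.
elim: n => [|n ih]; first by rewrite expr0 act1.
by rewrite exprS actM actZl actX nrmZ normcV t1 invr1 mul1r iso_nrm.
Qed.

Lemma normc_Sn_inv n : normc (n.+1%:R^-1 : R[i]) = n.+1%:R^-1.
Proof. by rewrite normcV normc_nat. Qed.

Lemma nrm_twisted_avg n f : nrm (act U (K n) f) <= nrm f.
Proof.
rewrite actZl nrmZ normc_Sn_inv ler_pdivrMl ?ltr0Sn// act_suml.
rewrite (le_trans (nrm_sum _ _))//; under eq_bigr do rewrite nrm_act_twist.
by rewrite sumr_const card_ord mulr_natl.
Qed.

Lemma twisted_avgM n : K n * (Y - 1) = n.+1%:R^-1 *: (Y ^+ n.+1 - 1).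
Proof. by rewrite -scalerAl subrX1 mulrC. Qed.

(** Every [Y ^+ i - 1] is a multiple of [Y - 1]. Hence [act U (K m) f - f] is a coboundary, which
    long averages almost annihilate: averaging first with [K m] does not change the limit. *)
Lemma twisted_avg_sub1 n : exists r, K n - 1 = (Y - 1) * r.
Proof.
exists (n.+1%:R^-1 *: \sum_(i < n.+1) \sum_(j < i) Y ^+ j).
have {1}-> : 1 = (n.+1%:R : R[i])^-1 *: \sum_(i < n.+1) (1 : {poly R[i]}).
  by rewrite sumr_const card_ord -(@scaler_nat R[i] {poly R[i]}) scalerA mulVf ?scale1r ?pnatr_eq0.
rewrite /twisted_avg -scalerBr -sumrB -scalerAr mulr_sumr; congr (_ *: _).
by apply: eq_bigr => i _; rewrite -subrX1.
Qed.

Lemma nrm_twisted_avg_coboundary n f :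
  nrm (act U (K n) (act U (Y - 1) f)) <= 2 * nrm f / n.+1%:R.
Proof.
rewrite -actM twisted_avgM actZl nrmZ normc_Sn_inv mulrC ler_pM2r ?invr_gt0//.
rewrite actBl act1 (le_trans (nrmB _ _))// nrm_act_twist; lra.
Qed.

Lemma div_cvg0 (a e : R) : 0 < e -> \forall n \near \oo, a / n.+1%:R < e.
Proof.
move=> e0; near=> n; rewrite ltr_pdivrMr ?ltr0Sn// mulrC -ltr_pdivrMr//.
rewrite (@lt_le_trans _ _ n%:R) ?ler_nat//; near: n; exact: nbhs_infty_gtr.
Unshelve. all: by end_near. Qed.

Lemma twisted_avg_avg m f (e : R) : 0 < e -> \forall n \near \oo,
  nrm (act U (K n) (act U (K m) f) - act U (K n) f) < e.
Proof.
move=> e0; have [r mr] := twisted_avg_sub1 m.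
near=> n; rewrite -linearB/= -{2}[f](act1 U) -actBl mr actM.
rewrite (le_lt_trans (nrm_twisted_avg_coboundary _ _))//.
near: n; exact: div_cvg0.
Unshelve. all: by end_near. Qed.

Lemma horner_twisted_avg n : (K n).[t] = 1.
Proof.
rewrite /K hornerZ horner_sum.
under eq_bigr do rewrite horner_exp hornerZ hornerX mulVf ?unit_circle_neq0//
  expr1n.
by rewrite sumr_const card_ord mulVf// pnatr_eq0.
Qed.

(** The operator [t^-1 U] preserves inner products and fixes [h]. *)
Lemma ip_twist n f h : U h = t *: h -> ip (act U (Y ^+ n) f) h = ip f h.
Proof.
move=> Uh; elim: n => [|n ih]; first by rewrite expr0 act1.
rewrite exprS actM actZl actX -ih -[RHS]isoU Uh (ipZl ipH) (ipZr ipH).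
congr (_ * _); apply: (mulIf unit_circle_neq0); rewrite mulVf ?unit_circle_neq0//.
by rewrite mulrC -normc_sqr t1 expr1n.
Qed.

Lemma ip_twisted_avg n f h : U h = t *: h -> ip (act U (K n) f) h = ip f h.
Proof.
move=> Uh; rewrite actZl (ipZl ipH) act_suml (ip_suml ipH).
under eq_bigr do rewrite (ip_twist _ _ Uh).
by rewrite sumr_const card_ord -[X in _ * X]mulr_natl mulKf// pnatr_eq0.
Qed.

(* The norms of the averages converge to their infimum [I], and so do those of
   the half sums of two averages, so the averages are Cauchy by the
   parallelogram law. *)
Lemma twisted_avg_cauchy f (e : R) : 0 < e -> exists N, forall m n,
  (N <= m)%N -> (N <= n)%N -> nrm (act U (K m) f - act U (K n) f) < e.
Proof.
move=> e0; pose A := [set nrm (act U (K n) f) | n in [set: nat]].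
have A0 : A !=set0 by exists (nrm (act U (K 0) f)), 0%N.
have Alb : lbound A 0 by move=> _ [n _ <-]; exact: nrm_ge0.
have Ai : has_inf A by split=> //; exists 0.
have I_le n : inf A <= nrm (act U (K n) f) by apply: ge_inf; [exists 0|exists n].
have I0 : 0 <= inf A by exact: lb_le_inf.
have [d d0 dE] : exists2 d : R, 0 < d & 4 * (inf A + 2 * d) ^+ 2 - 4 * inf A ^+ 2
    < e ^+ 2.
  (* With I the infimum, the difference is 16 d I + 16 d^2, at most 16 d (I + 1) as [d <= 1]; this
     [d] makes it at most e^2 / 2. *)
  pose d := Num.min 1 (e ^+ 2 / (32 * (inf A + 1))).
  have p : 0 < 32 * (inf A + 1) by lra.
  have d0 : 0 < d by rewrite lt_min ltr01 divr_gt0 ?exprn_gt0.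
  exists d => //.
  have d1 : d <= 1 by rewrite ge_min lexx.
  have de : d * (32 * (inf A + 1)) <= e ^+ 2.
    by rewrite -ler_pdivlMr// ge_min lexx orbT.
  have dd : d * d <= d by rewrite ler_piMr// ltW.
  have e2 : 0 < e ^+ 2 by rewrite exprn_gt0.
  have -> : 4 * (inf A + 2 * d) ^+ 2 - 4 * inf A ^+ 2 =
    d * (32 * (inf A + 1)) / 2 + 16 * (d * d - d) by field.
  lra.
have [_ [m0 _ <-] m0I] := inf_adherent d0 Ai.
have [N _ NP] := twisted_avg_avg m0 f d0.
(* [K n] applied to the almost minimal [act U (K m0) f] does not increase its norm and is close to
   [act U (K n) f]. *)
have small n : (N <= n)%N -> nrm (act U (K n) f) <= inf A + 2 * d.
  move=> /NP /= nN.
  have := nrm_distD (act U (K n) (act U (K m0) f)) (act U (K n) f) 0.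
  rewrite !subr0 nrm_distC.
  have := nrm_twisted_avg n (act U (K m0) f); lra.
(* A further long average moves both summands close to [act U (K k) f] without increasing the norm
   of their sum, and [nrm (act U (K k) f)] is at least the infimum. *)
have half m n : 2 * inf A <= nrm (act U (K m) f + act U (K n) f).
  apply/ler_addgt0Pr => c c0; have c20 : 0 < c / 2 by lra.
  have [k km kn] : exists2 k,
      nrm (act U (K k) (act U (K m) f) - act U (K k) f) < c / 2 &
      nrm (act U (K k) (act U (K n) f) - act U (K k) f) < c / 2.
    have [k [km kn]] := filter_ex (filterI (twisted_avg_avg m f c20)
      (twisted_avg_avg n f c20)).
    by exists k.
  have := nrm_twisted_avg k (act U (K m) f + act U (K n) f).
  rewrite linearD/=.
  set a := act U (K k) (act U (K m) f) in km *.
  set b := act U (K k) (act U (K n) f) in kn *.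
  set x := act U (K k) f in km kn *.
  have : nrm (x + x) = 2 * nrm x.
    by rewrite -mulr2n -scaler_nat nrmZ normc_nat.
  have := nrm_distD (a + b) (x + x) 0; rewrite !subr0 nrm_distC opprD addrACA.
  have := nrmD (a - x) (b - x); have := I_le k; rewrite -/x; lra.
exists N => m n mN nN.
rewrite -(@ltr_pXn2r _ 2)// ?nnegrE ?nrm_ge0 ?(ltW e0)//.
have := parallelogram ipH (act U (K m) f) (act U (K n) f).
have := half m n; have := small m mN; have := small n nN.
have := I_le m; have := I_le n.
set a := nrm (act U (K m) f); set b := nrm (act U (K n) f).
set s := nrm (_ + _); set r := nrm (_ - _) => Ib Ia bd ad Is par.
have : a ^+ 2 <= (inf A + 2 * d) ^+ 2 by rewrite lerXn2r// ?nnegrE; lra.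
have : b ^+ 2 <= (inf A + 2 * d) ^+ 2 by rewrite lerXn2r// ?nnegrE; lra.
have : (2 * inf A) ^+ 2 <= s ^+ 2 by rewrite lerXn2r// ?nnegrE; lra.
rewrite exprMn; lra.
Qed.

(** The limit is fixed by [t^-1 U] because [Y - 1] sends [act U (K n) f] to a vector of norm O(1/n);
    orthogonality holds because averaging preserves inner products with eigenvectors, and so does
    the limit. *)
Theorem mean_ergodic f : exists g, [/\ U g = t *: g,
  (forall h, U h = t *: h -> ip (f - g) h = 0) &
  (fun n => act U (K n) f) @ \oo --> g].
Proof.
have [g /[dup] Kg /cvg_nrmP gP] := complH (twisted_avg_cauchy f).
exists g; split=> //.
- apply/eqP; rewrite -subr_eq0; apply/eqP/nrm_eq0/le_anti.
  rewrite nrm_ge0 andbT; apply: le0_of_le_pos => e e0.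
  have [e' e3 eE] : exists2 e', 0 < e' & e = e' + e' + e' :> R.
    by exists (e / 3); [lra|field].
  have [n [n1 n2]] := filter_ex (filterI (gP _ e3) (div_cvg0 (2 * nrm f) e3)).
  have -> : U g - t *: g = t *: act U (Y - 1) g.
    rewrite actBl act1 actZl actX scalerBr scalerA mulfV ?unit_circle_neq0//.
    by rewrite scale1r.
  rewrite nrmZ t1 mul1r.
  have : nrm (act U (Y - 1) (g - act U (K n) f)) <= 2 * nrm (act U (K n) f - g).
    rewrite nrm_distC actBl act1 (le_trans (nrmB _ _))//.
    rewrite -[Y]expr1 nrm_act_twist nrm_distC; lra.
  have := nrm_twisted_avg_coboundary n f; rewrite (act_comm U (K n)).
  have := nrmD (act U (Y - 1) (g - act U (K n) f)) (act U (Y - 1) (act U (K n) f)).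
  rewrite -(linearD (act U (Y - 1))) subrK => i1 i2 i3; rewrite /= in n1 n2.
  have : 2 * nrm (act U (K n) f - g) + 2 * nrm f / n.+1%:R <= e.
    by rewrite eE [2 * nrm (_ - _)]mulr_natl mulr2n !lerD// ltW.
  by apply: le_trans; apply: le_trans i1 _; exact: lerD.
- move=> h Uh; apply/eq0_normc/le_anti; rewrite Defs.normc_ge0 andbT.
  apply: le0_of_le_pos => e e0.
  have h0 : 0 < nrm h + 1 by rewrite ltr_wpDl ?nrm_ge0.
  have [n /= ng] := filter_ex (gP _ (divr_gt0 e0 h0)).
  have -> : ip (f - g) h = ip (act U (K n) f - g) h.
    by rewrite !(ipBl ipH) ip_twisted_avg.
  rewrite (le_trans (cauchy_schwarz ipH _ _))//.
  have /ltW := ng; rewrite ler_pdivlMr//; apply: le_trans.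
  by rewrite ler_wpM2l ?nrm_ge0// lerDl.
Qed.

End mean_ergodic.

(** * Points of the circle and Parseval's identity on a finite cyclic group *)

Section circle.
Context (R : realType).
Implicit Types x y : R.

Definition expi x : R[i] := cos (2 * pi * x) +i* sin (2 * pi * x).

Lemma expiD x y : expi (x + y) = expi x * expi y.
Proof.
rewrite /expi mulrDr cosD sinD; apply/eqP; rewrite eq_complex /= eqxx/=.
by apply/eqP; ring.
Qed.

Lemma expi0 : expi 0 = 1.
Proof. by rewrite /expi mulr0 cos0 sin0. Qed.

Lemma expi1 : expi 1 = 1.
Proof. by rewrite /expi mulr1 mulr_natl cos2pi sin2pi. Qed.

Lemma expiX x n : expi x ^+ n = expi (n%:R * x).
Proof.
elim: n => [|n ih]; first by rewrite expr0 mul0r expi0.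
by rewrite exprSr ih -expiD -natr1 mulrDl mul1r.
Qed.

Lemma normc_expi x : normc (expi x) = 1.
Proof. by rewrite /= cos2Dsin2 sqrtr1. Qed.

(** The real part is 1 - 2 sin(pi x)^2, and the sine is positive strictly between 0 and pi. *)
Lemma expi_neq1 x : 0 < x < 1 -> expi x != 1.
Proof.
move=> /andP[x0 x1]; apply/eqP => -[+ _].
rewrite -mulrA mulr_natl cos_mulr2n => cos1.
have : 0 < sin (pi * x) ^+ 2.
  by rewrite exprn_gt0// sin_gt0_pi// mulr_gt0 ?pi_gt0//= gtr_pMr// pi_gt0.
have := cos2Dsin2 (pi * x); rewrite mulr2n in cos1; lra.
Qed.

Lemma expi_nat n : expi n%:R = 1.
Proof. by rewrite -[n%:R]mulr1 -expiX expi1 expr1n. Qed.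

End circle.

Section discrete_parseval.
Context (R : realType) (L : nat).
Hypothesis L0 : (0 < L)%N.
Local Notation z := (expi (L%:R^-1 : R)).

Lemma expi_root_neq (j k : nat) : (j < k < L)%N -> z ^+ j != z ^+ k.
Proof.
move=> /andP[jk kL]; have zu : z ^+ j != 0.
  by rewrite expf_neq0// (@unit_circle_neq0 R)// normc_expi.
rewrite -(subnKC (ltnW jk)) exprD -subr_eq0 -{1}[z ^+ j]mulr1 -mulrBr mulf_neq0//.
rewrite subr_eq0 eq_sym expiX expi_neq1//.
rewrite ltr_pdivlMr ?ltr0n// mul0r ltr0n subn_gt0 jk/=.
by rewrite ltr_pdivrMr ?ltr0n// mul1r ltr_nat (leq_ltn_trans (leq_subr _ _)).
Qed.

(** The sum is geometric with ratio [w], where [w ^+ L = 1], and [w] differs from 1 unless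
    [j = k]. *)
Lemma expi_root_orthogonal (j k : 'I_L) :
  \sum_(l < L) (z ^+ l) ^+ j * conjc ((z ^+ l) ^+ k) = (j == k)%:R * L%:R.
Proof.
set w := z ^+ j * conjc (z ^+ k).
have -> : \sum_(l < L) (z ^+ l) ^+ j * conjc ((z ^+ l) ^+ k) = \sum_(l < L) w ^+ l.
  by apply: eq_bigr => l _; rewrite /w exprMn -rmorphXn/= -!exprM ![(_ * l)%N]mulnC.
have zk : z ^+ k * conjc (z ^+ k) = 1.
  by rewrite -normc_sqr normcX normc_expi !expr1n.
have [jk|jk] := eqVneq j k.
  rewrite mul1r (eq_bigr (fun=> 1)) => [|l _]; last by rewrite /w jk zk expr1n.
  by rewrite sumr_const card_ord.
have zL : z ^+ L = 1 by rewrite expiX mulfV ?expi1// pnatr_eq0 -lt0n.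
have zn0 : conjc (z ^+ k) != 0.
  by apply: contra_eq_neq zk => ->; rewrite mulr0 eq_sym oner_eq0.
rewrite mul0r; apply: (@mulfI _ (w - 1)).
  rewrite subr_eq0 -zk; apply/negP => /eqP/(mulIf zn0)/eqP.
  have := ltn_ord j; have := ltn_ord k => kL jL.
  case: (ltngtP j k) => [jk'|kj|/val_inj/eqP]; last by rewrite (negbTE jk).
    by rewrite (negbTE (expi_root_neq _)) ?jk'.
  by rewrite eq_sym (negbTE (expi_root_neq _)) ?kj.
rewrite mulr0 -subrX1 exprMn -rmorphXn/= -!exprM mulnC exprM zL expr1n.
by rewrite mulnC exprM zL expr1n conjc1 mulr1 subrr.
Qed.

Context (H : normedModType R[i]) (ip : H -> H -> R[i]).
Hypothesis ipH : inner_product ip.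

Lemma discrete_parseval (y : nat -> H) :
  \sum_(l < L) nrm (\sum_(m < L) (z ^+ l) ^+ m *: y m) ^+ 2 =
  L%:R * \sum_(m < L) nrm (y m) ^+ 2.
Proof.
apply: complexI; rewrite rmorph_sum/= rmorphM/= rmorph_nat rmorph_sum/=.
rewrite (eq_bigr (fun l : 'I_L => \sum_(j < L) \sum_(k < L)
    (z ^+ l) ^+ j * conjc ((z ^+ l) ^+ k) * ip (y j) (y k))); last first.
  move=> l _; rewrite -(ip_nrm ipH) (ip_suml ipH); apply: eq_bigr => j _.
  rewrite (ip_sumr ipH); apply: eq_bigr => k _.
  by rewrite (ipZl ipH) (ipZr ipH) mulrA.
rewrite exchange_big/= mulr_sumr; apply: eq_bigr => j _.
rewrite exchange_big/= (bigD1 j)//= -mulr_suml expi_root_orthogonal eqxx mul1r.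
rewrite (ip_nrm ipH) big1 ?addr0// => k kj.
by rewrite -mulr_suml expi_root_orthogonal eq_sym (negbTE kj) !mul0r.
Qed.

End discrete_parseval.

(** * From bounds on the circle to bounds for operators *)

Section domination.
Context (R : realType) (H : normedModType R[i]) (ip : H -> H -> R[i]).
Context (U : {linear H -> H}).
Hypotheses (ipH : inner_product ip).
Hypotheses (isoU : forall f g, ip (U f) (U g) = ip f g).
Implicit Types (f g h : H) (p q : {poly R[i]}) (z : R[i]).

Section convolution.
Variables (N D : nat) (f : H).

(* Convolution of the coefficients of p with the sequence U^(N-1) f, ..., U f, f. *)
Definition orbit_conv p m : H := \sum_(i < D)
  (if (i <= m < N + i)%N then p`_i *: iter (N.-1 + i - m) U f else 0).

(** The length [N + D] leaves room for the whole convolution, so nothing is cut off and the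
    transform is the product of the two transforms. *)
Lemma transform_orbit_conv p z : (size p <= D)%N ->
  \sum_(m < N + D) z ^+ m *: orbit_conv p m =
  p.[z] *: \sum_(j < N) z ^+ j *: iter (N.-1 - j) U f.
Proof.
move=> pD; rewrite (horner_coef_wide _ pD) scaler_suml.
under eq_bigr do rewrite scaler_sumr.
rewrite exchange_big/=; apply: eq_bigr => -[i /= iD] _.
rewrite -(big_mkord xpredT (fun m => z ^+ m *:
  if (i <= m < N + i)%N then p`_i *: iter (N.-1 + i - m) U f else 0)).
rewrite (@big_cat_nat _ _ _ i)//=; last by rewrite (leq_trans (ltnW iD))// leq_addl.
rewrite [X in X + _]big_nat_cond big1 ?add0r; last first.
  by move=> m /andP[/andP[_ mi] _]; rewrite leqNgt mi scaler0.
rewrite (@big_cat_nat _ _ _ (N + i))//= ?leq_addl ?leq_add2l ?(ltnW iD)//.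
rewrite [X in _ + X]big_nat_cond [X in _ + X]big1 ?addr0; last first.
  by move=> m /andP[/andP[mi _] _]; rewrite [(m < _)%N]ltnNge mi andbF scaler0.
rewrite -{1}(add0n i) big_addn addnK big_mkord scaler_sumr; apply: eq_bigr => j _.
rewrite leq_addl ltn_add2r ltn_ord/= subnDr !scalerA exprD; congr (_ *: _); ring.
Qed.

(** This is why the orbit is reversed: away from both ends no term is cut off, and the convolution
    at [m] is U^(N-1-m) applied to [act U p f]. *)
Lemma nrm_orbit_conv_bulk p m : (size p <= D)%N -> (D <= m < N)%N ->
  nrm (orbit_conv p m) = nrm (act U p f).
Proof.
move=> pD /andP[Dm mN]; rewrite -[RHS](nrm_iter (iso_nrm ipH isoU) (N.-1 - m)).
rewrite -actXn act_comm (act_wide _ _ pD) actXn; congr nrm; apply: eq_bigr => i _.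
have im : (i <= m)%N by rewrite (leq_trans _ Dm)// ltnW.
rewrite im (leq_trans mN (leq_addr _ _))/= addnC -addnBA ?iterD//.
by rewrite -ltnS prednK// (leq_ltn_trans _ mN).
Qed.

Lemma nrm_orbit_conv_le p m :
  nrm (orbit_conv p m) <= (\sum_(i < D) normc p`_i) * nrm f.
Proof.
rewrite (le_trans (nrm_sum _ _))// mulr_suml ler_sum// => i _.
case: ifP => _; last by rewrite nrm0 mulr_ge0 ?nrm_ge0 ?Defs.normc_ge0.
by rewrite nrmZ (nrm_iter (iso_nrm ipH isoU)).
Qed.

Lemma orbit_conv_energy_ge p : (size p <= D)%N -> (D <= N)%N ->
  (N%:R - D%:R) * nrm (act U p f) ^+ 2 <=
  \sum_(m < N + D) nrm (orbit_conv p m) ^+ 2.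
Proof.
move=> pD DN; rewrite -(big_mkord xpredT (fun m => nrm (orbit_conv p m) ^+ 2)).
rewrite (@big_cat_nat _ _ _ D)//= ?leq_addl//
  [X in _ <= _ + X](@big_cat_nat _ _ _ N)//= ?leq_addr//.
rewrite ler_wpDl ?sumr_ge0 ?ler_wpDr ?sumr_ge0// => [m _|m _|]; rewrite ?sqr_ge0//.
rewrite (eq_big_nat _ _ (F2 := fun=> nrm (act U p f) ^+ 2)) => [|m mDN].
  by rewrite sumr_const_nat -[leRHS]mulr_natl natrB.
by rewrite nrm_orbit_conv_bulk.
Qed.

(** Only [2 D] indices, at the two ends, escape [nrm_orbit_conv_bulk], and each costs at most a
    constant independent of [N]. *)
Lemma orbit_conv_energy_le p : (size p <= D)%N -> (D <= N)%N ->
  \sum_(m < N + D) nrm (orbit_conv p m) ^+ 2 <=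
  N%:R * nrm (act U p f) ^+ 2 +
  D%:R * 2 * ((\sum_(i < D) normc p`_i) * nrm f) ^+ 2.
Proof.
move=> pD DN; rewrite -(big_mkord xpredT (fun m => nrm (orbit_conv p m) ^+ 2)).
rewrite (@big_cat_nat _ _ _ D)//= ?leq_addl//
  [X in _ + X <= _](@big_cat_nat _ _ _ N)//= ?leq_addr//.
set B := ((\sum_(i < D) _) * _) ^+ 2.
have leB m : nrm (orbit_conv p m) ^+ 2 <= B.
  by rewrite lerXn2r ?nnegrE ?nrm_ge0 ?nrm_orbit_conv_le// (le_trans (nrm_ge0 _)
    (nrm_orbit_conv_le p m)).
have B1 : \sum_(0 <= m < D) nrm (orbit_conv p m) ^+ 2 <= D%:R * B.
  rewrite (le_trans (ler_sum _ (fun m _ => leB m)))// sumr_const_nat subn0.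
  by rewrite mulr_natl.
have B2 : \sum_(N <= m < N + D) nrm (orbit_conv p m) ^+ 2 <= D%:R * B.
  rewrite (le_trans (ler_sum _ (fun m _ => leB m)))// sumr_const_nat addKn.
  by rewrite mulr_natl.
have B3 : \sum_(D <= m < N) nrm (orbit_conv p m) ^+ 2 <= N%:R * nrm (act U p f) ^+ 2.
  rewrite (eq_big_nat _ _ (F2 := fun=> nrm (act U p f) ^+ 2)) => [|m mDN].
    by rewrite sumr_const_nat -[leLHS]mulr_natl ler_wpM2r ?sqr_ge0// ler_nat leq_subr.
  by rewrite nrm_orbit_conv_bulk.
by rewrite (le_trans (lerD B1 (lerD B3 B2)))// le_eqVlt; apply/orP; left; apply/eqP; ring.
Qed.

End convolution.

(** The last factor does not depend on [p], so it acts as a common weight through which a pointwise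
    inequality between values of polynomials can be summed. *)
Lemma orbit_conv_spectral N D p f : (size p <= D)%N -> (0 < N)%N ->
  (N + D)%:R * \sum_(m < N + D) nrm (orbit_conv N D f p m) ^+ 2 =
  \sum_(l < N + D) normc p.[expi (l%:R / (N + D)%:R)] ^+ 2 *
    nrm (\sum_(j < N) expi (l%:R / (N + D)%:R) ^+ j *: iter (N.-1 - j) U f) ^+ 2.
Proof.
move=> pD N0; have L0 : (0 < N + D)%N by rewrite addn_gt0 N0.
rewrite -(discrete_parseval L0 ipH); apply: eq_bigr => l _.
by rewrite expiX transform_orbit_conv// nrmZ exprMn.
Qed.

(* Parseval on Z/(N + D) transfers the pointwise bound on the circle to the
   convolutions, up to an error that stays bounded as N grows. *)
Theorem act_dominated (I : eqType) (r : seq I) (c : I -> R) (p : I -> {poly R[i]}) q f :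
  (forall i, 0 <= c i) ->
  (forall x : R, 0 <= x <= 1 ->
    normc q.[expi x] ^+ 2 <= \sum_(i <- r) c i * normc (p i).[expi x] ^+ 2) ->
  nrm (act U q f) ^+ 2 <= \sum_(i <- r) c i * nrm (act U (p i) f) ^+ 2.
Proof.
move=> c0 qp; set a := nrm _ ^+ 2; set b := \sum_(i <- r) _.
pose D := maxn (size q) (\max_(i <- r) size (p i)).
have qD : (size q <= D)%N by exact: leq_maxl.
have pD i : i \in r -> (size (p i) <= D)%N.
  by move=> ir; rewrite leq_max (@leq_bigmax_seq _ r xpredT (fun i => size (p i)) i)// orbT.
pose C := \sum_(i <- r) c i *
  (D%:R * 2 * ((\sum_(j < D) normc (p i)`_j) * nrm f) ^+ 2).
have key N : (D <= N)%N -> (0 < N)%N -> (N%:R - D%:R) * a <= N%:R * b + C.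
  move=> DN N0; have L0 : 0 < (N + D)%:R :> R by rewrite ltr0n addn_gt0 N0.
  apply: le_trans (orbit_conv_energy_ge f qD DN) _.
  have -> : N%:R * b + C = \sum_(i <- r) c i * (N%:R * nrm (act U (p i) f) ^+ 2 +
      D%:R * 2 * ((\sum_(j < D) normc (p i)`_j) * nrm f) ^+ 2).
    rewrite /b /C mulr_sumr -big_split; apply: eq_bigr => i _ /=; ring.
  apply: (@le_trans _ _ (\sum_(i <- r) c i *
      \sum_(m < N + D) nrm (orbit_conv N D f (p i) m) ^+ 2)); last first.
    rewrite big_seq [leRHS]big_seq ler_sum// => i ir.
    by rewrite ler_wpM2l// orbit_conv_energy_le// pD.
  have spec : (N + D)%:R * \sum_(i <- r) c i *
        \sum_(m < N + D) nrm (orbit_conv N D f (p i) m) ^+ 2 =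
      \sum_(l < N + D) \sum_(i <- r)
        c i * normc (p i).[expi (l%:R / (N + D)%:R)] ^+ 2 *
        nrm (\sum_(j < N) expi (l%:R / (N + D)%:R) ^+ j *: iter (N.-1 - j) U f) ^+ 2.
    rewrite exchange_big mulr_sumr/= big_seq [RHS]big_seq; apply: eq_bigr => i ir.
    rewrite mulrCA orbit_conv_spectral ?pD// mulr_sumr.
    by apply: eq_bigr => l _; rewrite mulrA.
  rewrite -(ler_pM2l L0) spec orbit_conv_spectral// ler_sum// => l _.
  rewrite -mulr_suml ler_wpM2r ?sqr_ge0// qp// divr_ge0 ?ler0n//=.
  by rewrite ler_pdivrMr// mul1r ler_nat ltnW.
(* The bound [key] says that [N (a - b) <= D a + C]; if [b < a], this fails for every [N] above the
   quotient [x]. *)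
rewrite leNgt; apply/negP => ba.
have ab : 0 < a - b by rewrite subr_gt0.
set x := (D%:R * a + C) / (a - b).
have := truncnS_gt x; rewrite ltr_pdivrMr// => xM.
have := key (D + (Num.truncn x).+1)%N (leq_addr _ _).
rewrite addnS => /(_ isT); rewrite -addnS natrD mulrBl => le.
have : 0 <= D%:R * (a - b) by rewrite mulr_ge0 ?ler0n ?(ltW ab).
move: xM le; rewrite mulrDl mulrDl mulrBr mulrBr; lra.
Qed.

End domination.

(** * Compactness of the circle *)

Section circle_polynomials.
Context (R : realType).
Implicit Types (p : {poly R[i]}) (x : R).

Lemma normc_sqE (z : R[i]) : normc z ^+ 2 = complex.Re z ^+ 2 + complex.Im z ^+ 2.
Proof. by case: z => a b /=; rewrite sqr_sqrtr// addr_ge0 ?sqr_ge0. Qed.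

Lemma horner_expi_continuous p :
  continuous (fun x => complex.Re p.[expi x]) /\
  continuous (fun x => complex.Im p.[expi x]).
Proof.
elim/poly_ind: p => [|p c [ReC ImC]].
  by split=> x; under eq_fun do rewrite horner0; exact: cvg_cst.
have arg : continuous (fun x : R => 2 * pi * x).
  by move=> x; apply: cvgM; [exact: cvg_cst|exact: cvg_id].
have cosC : continuous (fun x : R => cos (2 * pi * x)).
  move=> x; apply: (@continuous_comp _ _ _ _ cos); first exact: arg.
  exact: continuous_cos.
have sinC : continuous (fun x : R => sin (2 * pi * x)).
  move=> x; apply: (@continuous_comp _ _ _ _ sin); first exact: arg.
  exact: continuous_sin.
split=> x.
  have -> : (fun x => complex.Re (p * 'X + c%:P).[expi x]) = (fun x =>
      complex.Re p.[expi x] * cos (2 * pi * x) -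
      complex.Im p.[expi x] * sin (2 * pi * x) + complex.Re c).
    by apply/funext => y; rewrite hornerMXaddC; case: p.[_] => ? ?; case: c.
  apply: cvgD; last exact: cvg_cst.
  by apply: cvgB; apply: cvgM; [exact: ReC|exact: cosC|exact: ImC|exact: sinC].
have -> : (fun x => complex.Im (p * 'X + c%:P).[expi x]) = (fun x =>
    complex.Re p.[expi x] * sin (2 * pi * x) +
    complex.Im p.[expi x] * cos (2 * pi * x) + complex.Im c).
  by apply/funext => y; rewrite hornerMXaddC; case: p.[_] => ? ?; case: c.
apply: cvgD; last exact: cvg_cst.
by apply: cvgD; apply: cvgM; [exact: ReC|exact: sinC|exact: ImC|exact: cosC].
Qed.

Lemma normc_horner_expi_continuous p :
  continuous (fun x => normc p.[expi x] ^+ 2).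
Proof.
have [ReC ImC] := horner_expi_continuous p; move=> x.
have -> : (fun x => normc p.[expi x] ^+ 2) = (fun x =>
    complex.Re p.[expi x] * complex.Re p.[expi x] +
    complex.Im p.[expi x] * complex.Im p.[expi x]).
  by apply/funext => y; rewrite normc_sqE !expr2.
by apply: cvgD; apply: cvgM; [exact: ReC|exact: ReC|exact: ImC|exact: ImC].
Qed.

(* At a point t i the i-th term is at least 1/2 nearby; at any other point q d is
   small for large d. The near-covering form of compactness makes this uniform. *)
Lemma circle_domination (I : choiceType) (t : I -> R[i])
    (q : nat -> {poly R[i]}) (K : I -> {poly R[i]}) (e : R) :
  (forall d z, normc z = 1 -> normc (q d).[z] <= 1) ->
  (forall d d' z, normc z = 1 -> (d <= d')%N ->
     normc (q d').[z] <= normc (q d).[z]) ->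
  (forall x, (exists i, t i = expi x) \/
     (q d).[expi x] @[d --> \oo] --> (0 : R[i])) ->
  (forall i, (K i).[t i] = 1) -> 0 < e ->
  exists A : {fset I}, \forall d \near \oo, forall x, 0 <= x <= 1 ->
    normc (q d).[expi x] ^+ 2 <=
      e + \sum_(i <- A) 2 * normc (K i).[expi x] ^+ 2.
Proof.
move=> q1 qdec qt K1 e0.
(* The finite set and the degree grow together along this filter. Enlarging the set only adds
   nonnegative terms, so each local bound persists. *)
pose F := filter_prod (@totally I) (\oo : set_system nat).
pose P (Ad : {fset I} * nat) (x : R) := normc (q Ad.2).[expi x] ^+ 2 <=
      e + \sum_(i <- Ad.1) 2 * normc (K i).[expi x] ^+ 2.
have sum_ge0 (A : {fset I}) x : 0 <= \sum_(i <- A) 2 * normc (K i).[expi x] ^+ 2.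
  by apply: sumr_ge0 => i _; rewrite mulr_ge0// sqr_ge0.
have tF : ProperFilter (@totally I) by exact: totally_filter.
have FF : Filter F by exact: filter_prod_filter.
have loc (x : R) : `[0%R, 1%R]%classic x ->
    \forall x' \near x & Ad \near F, P Ad x'.
  move=> _; have [[i ti]|] := qt x.
    have half : \forall x' \near x, 1 / 2 < normc (K i).[expi x'] ^+ 2.
      have /cvgr_gt := @normc_horner_expi_continuous (K i) x; apply.
      by rewrite -ti K1 normc1 expr1n; lra.
    exists ([set x' | 1 / 2 < normc (K i).[expi x'] ^+ 2],
      [set Ad : {fset I} * nat | i \in Ad.1]); first split => //=.
      exists ([set A : {fset I} | i \in A], setT); last by move=> [A d] [].
      split=> /=; last exact: filterT.
      exists [fset i]%fset => // A /=; by rewrite fsub1set.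
    move=> [x' [A d]] /= [xh iA]; rewrite /P/=.
    have : normc (q d).[expi x'] ^+ 2 <= 1.
      by rewrite exprn_ile1 ?Defs.normc_ge0// q1// normc_expi.
    have : 2 * normc (K i).[expi x'] ^+ 2 <=
        \sum_(i <- A) 2 * normc (K i).[expi x'] ^+ 2.
      rewrite (big_rem i)//= lerDl sumr_ge0// => j _.
      by rewrite mulr_ge0// sqr_ge0.
    lra.
  move=> /cvg_normcP q0.
  have [d0 /= d0e] : exists d, normc (q d).[expi x] ^+ 2 < e.
    (* A modulus below both 1 and [e] has its square below [e]. *)
    have m0 : 0 < Num.min 1 e by rewrite lt_min ltr01.
    have [d /=] := filter_ex (q0 _ m0).
    rewrite subr0 lt_min => /andP[d1 de]; exists d.
    by rewrite (le_lt_trans _ de)// expr2 ler_piMl ?Defs.normc_ge0// ltW.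
  have small : \forall x' \near x, normc (q d0).[expi x'] ^+ 2 < e.
    by have /cvgr_lt := @normc_horner_expi_continuous (q d0) x; apply.
  exists ([set x' | normc (q d0).[expi x'] ^+ 2 < e],
    [set Ad : {fset I} * nat | (d0 <= Ad.2)%N]); first split => //=.
    exists (setT, [set d | (d0 <= d)%N]); last by move=> [A d] [].
    by split=> /=; [exact: filterT|exact: nbhs_infty_ge].
  move=> [x' [A d]] /= [xe dd]; rewrite /P/= ler_wpDr//.
  rewrite (le_trans _ (ltW xe))// lerXn2r ?nnegrE ?Defs.normc_ge0//.
  by rewrite qdec// normc_expi.
have /compact_near_coveringP cov := @segment_compact R 0 1.
have [[S1 S2] /= [[A _ AS1] S2o] SP] := cov _ _ P FF loc.
exists A; apply: filterS S2o => d S2d x x01.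
apply: (SP (A, d)) => /=; first by split=> //; exact: (AS1 A (fsubset_refl A)).
by rewrite in_itv.
Qed.

(** Distinct ranks make this a part of the geometric series. The bound is uniform in [r], so the
    errors can be assigned before the finite set is known. *)
Lemma sum_half_pow (I : eqType) (rank : I -> nat) (r : seq I) :
  injective rank -> uniq r ->
  \sum_(i <- r) (2^-1 : R) ^+ (rank i).+1 <= 1.
Proof.
move=> rankI ur.
have fin n : \sum_(k < n) (2^-1 : R) ^+ k.+1 = 1 - 2^-1 ^+ n.
  elim: n => [|n ih]; first by rewrite big_ord0 expr0 subrr.
  by rewrite big_ord_recr /= ih exprS; field.
pose n := (\max_(i <- r) rank i).+1.
have rn i : i \in r -> (rank i < n)%N.
  by move=> ir; rewrite ltnS (@leq_bigmax_seq _ r xpredT rank i).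
rewrite (@le_trans _ _ (\sum_(k < n) (2^-1 : R) ^+ k.+1))//; last first.
  by rewrite fin lerBlDr lerDl exprn_ge0// invr_ge0.
rewrite -(big_map rank xpredT (fun k => (2^-1 : R) ^+ k.+1)).
rewrite -(big_mkord xpredT (fun k => (2^-1 : R) ^+ k.+1)).
apply: (@le_trans _ _ (\sum_(k <- [seq k <- index_iota 0 n | k \in map rank r])
    (2^-1 : R) ^+ k.+1)).
  rewrite (perm_big [seq k <- index_iota 0 n | k \in map rank r])//.
  apply: uniq_perm; rewrite ?filter_uniq ?iota_uniq ?map_inj_uniq// => k.
  rewrite mem_filter mem_index_iota /=.
  case kr: (k \in map rank r) => //=.
  by move: kr => /mapP[i ir ->]; rewrite rn.
rewrite big_filter big_mkcond/= ler_sum// => k _.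
by case: ifP => // _; rewrite exprn_ge0// invr_ge0.
Qed.

End circle_polynomials.

(** * Convergence of the averages for an abstract isometry *)

Section spectral_limit.
Context (R : realType) (H : normedModType R[i]) (ip : H -> H -> R[i]).
Context (U : {linear H -> H}).
Hypotheses (ipH : inner_product ip) (complH : sequentially_complete H).
Hypotheses (isoU : forall f g, ip (U f) (U g) = ip f g).
Context (I : choiceType) (t : I -> R[i]) (rank : I -> nat).
Hypotheses (tI : injective t) (t1 : forall i, normc (t i) = 1).
Hypothesis rankI : injective rank.
Context (P : I -> H -> H).
Hypothesis P_eigen : forall i f, U (P i f) = t i *: P i f.
Hypothesis P_orth : forall i f h, U h = t i *: h -> ip (f - P i f) h = 0.
Implicit Types (f g h : H) (r : seq I).

Lemma ip_eigen i j g h : i != j -> U g = t i *: g -> U h = t j *: h -> ip g h = 0.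
Proof.
move=> ij Ug Uh; have := isoU g h; rewrite Ug Uh (ipZl ipH) (ipZr ipH) mulrA.
move=> /eqP; rewrite -subr_eq0 -[X in _ - X]mul1r -mulrBl mulf_eq0 subr_eq0.
case/orP => /eqP // tij; have : t i * (t j)^*%C = t j * (t j)^*%C.
  by rewrite tij -normc_sqr t1 expr1n.
have tj0 : (t j)^*%C != 0 by rewrite conjc_eq0 unit_circle_neq0.
by move=> /(mulIf tj0)/tI/eqP; rewrite (negbTE ij).
Qed.

(** The difference of the two candidates is an eigenvector orthogonal to itself. This identifies the
    ergodic limit with [P i f]. *)
Lemma proj_unique i f g : U g = t i *: g ->
  (forall h, U h = t i *: h -> ip (f - g) h = 0) -> g = P i f.
Proof.
move=> Ug og; apply/eqP; rewrite -subr_eq0; apply/eqP/nrm_eq0/eqP.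
rewrite -sqrf_eq0; apply/eqP/complexI; rewrite -(ip_nrm ipH).
have Uk : U (g - P i f) = t i *: (g - P i f).
  by rewrite linearB/= Ug P_eigen scalerBr.
have := og _ Uk; have := P_orth f Uk.
rewrite !(ipBl ipH) => /eqP; rewrite subr_eq0 => /eqP <- /eqP.
by rewrite subr_eq0 => /eqP ->; rewrite subrr.
Qed.

Lemma ip_proj_sum r f j h : uniq r -> U h = t j *: h ->
  ip (\sum_(i <- r) P i f) h = if j \in r then ip f h else 0.
Proof.
move=> ur Uh; rewrite (ip_suml ipH); case: ifPn => jr.
  rewrite (big_rem j)//= big_seq big1 ?addr0.
    by have /eqP := P_orth f Uh; rewrite (ipBl ipH) subr_eq0 => /eqP.
  move=> i; rewrite mem_rem_uniq// inE => /andP[ij _].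
  exact: ip_eigen ij (P_eigen i f) Uh.
rewrite big_seq big1// => i ir; apply: ip_eigen (P_eigen i f) Uh.
by apply: contraNneq jr => <-.
Qed.

Lemma proj_residual r f j : uniq r ->
  P j (f - \sum_(i <- r) P i f) = if j \in r then 0 else P j f.
Proof.
move=> ur; apply/esym/proj_unique => [|h Uh].
  by case: ifP; rewrite ?linear0 ?scaler0.
rewrite !(ipBl ipH) (ip_proj_sum _ ur Uh); case: ifP => _.
  by rewrite subrr (ip0l ipH) subr0.
by rewrite subr0 -(ipBl ipH) P_orth.
Qed.

Lemma nrm_proj_sum (w : I -> R[i]) r f : uniq r ->
  nrm (\sum_(i <- r) w i *: P i f) ^+ 2 =
  \sum_(i <- r) normc (w i) ^+ 2 * nrm (P i f) ^+ 2.
Proof.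
move=> ur; rewrite (pythagoras ipH ur) => [|i j ir jr ij].
  by apply: eq_bigr => i _; rewrite nrmZ exprMn.
by rewrite (ipZl ipH) (ipZr ipH) (ip_eigen ij (P_eigen i f) (P_eigen j f)) !mulr0.
Qed.

Lemma nrm_residual r f : uniq r ->
  nrm f ^+ 2 = nrm (f - \sum_(i <- r) P i f) ^+ 2 + \sum_(i <- r) nrm (P i f) ^+ 2.
Proof.
move=> ur; rewrite -{1}(subrK (\sum_(i <- r) P i f) f) [LHS](nrm_sqD ipH).
have -> : ip (f - \sum_(i <- r) P i f) (\sum_(i <- r) P i f) = 0.
  rewrite (ip_sumr ipH) big_seq big1// => j jr.
  by rewrite (ipBl ipH) (ip_proj_sum _ ur (P_eigen j f)) jr subrr.
rewrite mulr0 addr0.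
congr (_ + _); have := nrm_proj_sum (fun=> 1) f ur.
under eq_bigr do rewrite scale1r; move=> ->.
by under eq_bigr do rewrite normc1 expr1n mul1r.
Qed.

Lemma bessel r f : uniq r -> \sum_(i <- r) nrm (P i f) ^+ 2 <= nrm f ^+ 2.
Proof. by move=> ur; rewrite (nrm_residual f ur) lerDr sqr_ge0. Qed.

(** Take [r] within [e] of the supremum of all these sums, finite by Bessel: a disjoint [s] can add
    no more than [e]. *)
Lemma exhausting_seq f (e : R) : 0 < e -> exists2 r, uniq r &
  forall s, uniq s -> {in s, forall i, i \notin r} ->
    \sum_(i <- s) nrm (P i f) ^+ 2 <= e.
Proof.
move=> e0; pose A := [set \sum_(i <- r) nrm (P i f) ^+ 2 | r in uniq].
have As : has_sup A.
  split; first by exists 0, [::] => //; rewrite big_nil.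
  by exists (nrm f ^+ 2) => _ [r ur <-]; exact: bessel.
have [_ [r ur <-] rA] := sup_adherent e0 As.
exists r => // s us sr.
have : \sum_(i <- r ++ s) nrm (P i f) ^+ 2 <= sup A.
  apply: ub_le_sup; first by case: As.
  exists (r ++ s) => //=; rewrite cat_uniq ur us/= andbT.
  by apply/hasPn => i /sr.
rewrite big_cat/=; lra.
Qed.

Lemma nrm_sq_near (l : H) (d : R) : 0 < d -> exists2 e : R, 0 < e &
  (forall u, nrm (u - l) < e -> nrm u ^+ 2 <= nrm l ^+ 2 + d).
Proof.
move=> d0; have p : 0 < 2 * nrm l + 1 by have := nrm_ge0 l; lra.
(* At distance x <= 1 from [l] the square grows by at most 2 x [nrm l] + x^2, hence by at most x (2
   [nrm l] + 1). *)
exists (Num.min 1 (d / (2 * nrm l + 1))).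
  by rewrite lt_min ltr01 divr_gt0.
move=> u; rewrite lt_min ltr_pdivlMr// => /andP[u1 ud].
have ul : nrm u <= nrm l + nrm (u - l).
  by rewrite -{1}(subrK l u) addrC (le_trans (nrmD _ _)).
have : nrm u ^+ 2 <= (nrm l + nrm (u - l)) ^+ 2.
  by rewrite lerXn2r ?nnegrE ?nrm_ge0// addr_ge0 ?nrm_ge0.
have : nrm (u - l) ^+ 2 <= nrm (u - l).
  by rewrite expr2 ler_piMl ?nrm_ge0// ltW.
rewrite sqrrD -mulr_natl; lra.
Qed.

Context (q : nat -> {poly R[i]}) (w : I -> R[i]).
Hypothesis q1 : forall d z, normc z = 1 -> normc (q d).[z] <= 1.
Hypothesis q_dec : forall d d' z, normc z = 1 -> (d <= d')%N ->
  normc (q d').[z] <= normc (q d).[z].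
Hypothesis q_vanish : forall x, (exists i, t i = expi x) \/
  (q d).[expi x] @[d --> \oo] --> (0 : R[i]).
Hypothesis q_lim : forall i, (q d).[t i] @[d --> \oo] --> w i.

(** On the residual f' the constant part of the domination contributes e |f'|^2. The ergodic
    polynomials contribute 2 (e + e): one [e] bounds the sum of the |P_i f'|^2, which vanish for i
    in [r], the other the total approximation error. *)
Lemma residual_small r f (e : R) : uniq r -> 0 < e ->
  (forall s, uniq s -> {in s, forall i, i \notin r} ->
    \sum_(i <- s) nrm (P i f) ^+ 2 <= e) ->
  \forall d \near \oo, nrm (act U (q d) (f - \sum_(i <- r) P i f)) ^+ 2 <=
    e * (nrm f ^+ 2 + 4).
Proof.
move=> ur e0 tail; set f' := f - _.
(* Chosen for every [i], before compactness singles out a finite set; hence the error weighted by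
   the rank. *)
have exK i : exists K : {poly R[i]}, K.[t i] = 1 /\
    nrm (act U K f') ^+ 2 <= nrm (P i f') ^+ 2 + e * 2^-1 ^+ (rank i).+1.
  have [g [Ug og /cvg_nrmP Kg]] := mean_ergodic ipH complH isoU (t1 i) f'.
  rewrite -(proj_unique Ug og).
  have d0 : 0 < e * 2^-1 ^+ (rank i).+1 by rewrite mulr_gt0// exprn_gt0.
  have [n] : exists n, nrm (act U (twisted_avg (t i) n) f') ^+ 2 <=
      nrm g ^+ 2 + e * 2^-1 ^+ (rank i).+1.
    have [d dp near_g] := nrm_sq_near g d0.
    by have [n /near_g] := filter_ex (Kg _ dp); exists n.
  by exists (twisted_avg (t i) n); rewrite horner_twisted_avg.
have {exK} [K /all_and2[K1 Kf']] := choice exK.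
have [A Ad] := circle_domination q1 q_dec q_vanish K1 e0.
apply: filterS Ad => d /= dom.
(* The index [None] carries the constant [e] as a multiple of the polynomial 1, so that the
   domination has the form required by [act_dominated]. *)
pose c (i : option I) : R := if i is Some _ then 2 else e.
pose p (i : option I) := if i is Some j then K j else 1.
have c0 i : 0 <= c i by case: i => [i|] //=; exact: ltW.
have /= := act_dominated ipH isoU (r := None :: map Some A) (c := c) (p := p)
  (q := q d) f' c0 _.
rewrite !big_cons !big_map/= act1 => /(_ _)/le_trans; apply.
  by move=> x x01; rewrite big_cons big_map/= hornerC normc1 expr1n mulr1 dom.
have f'f : nrm f' ^+ 2 <= nrm f ^+ 2.
  rewrite (nrm_residual f ur) -/f' lerDl sumr_ge0// => i _; exact: sqr_ge0.
have sP : \sum_(i <- A) nrm (P i f') ^+ 2 <= e.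
  rewrite (bigID (fun i => i \in r))/= big1 ?add0r => [|i ir]; last first.
    by rewrite proj_residual// ir nrm0 expr0n.
  under eq_bigr => i ir do rewrite proj_residual// (negbTE ir).
  rewrite -big_filter tail ?filter_uniq ?fset_uniq// => i.
  by rewrite mem_filter => /andP[].
have sK : \sum_(i <- A) nrm (act U (K i) f') ^+ 2 <= e + e.
  rewrite (le_trans (ler_sum _ (fun i _ => Kf' i)))// big_split/= lerD//.
  by rewrite -mulr_sumr ler_piMr ?(ltW e0)// sum_half_pow// fset_uniq.
have ef : e * nrm f' ^+ 2 <= e * nrm f ^+ 2 by rewrite ler_pM2l.
rewrite -mulr_sumr mulrDr; lra.
Qed.

Lemma normc_lim_le1 i : normc (w i) <= 1.
Proof.
apply/ler_addgt0Pr => e e0; have /cvg_normcP/(_ e e0) := @q_lim i.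
move=> /filter_ex[d /= dw].
have -> : w i = (q d).[t i] - ((q d).[t i] - w i) by rewrite opprB addrC subrK.
by rewrite (le_trans (le_normcD _ _))// normcN lerD ?q1// ltW.
Qed.

Lemma horner_lim_sum r (x : I -> H) (e : R) : 0 < e -> \forall d \near \oo,
  nrm (\sum_(i <- r) ((q d).[t i] - w i) *: x i) < e.
Proof.
elim: r e => [|i r ih] e e0.
  by apply: nearW => d; rewrite big_nil nrm0.
have e2 : 0 < e / 2 by lra.
have x0 : 0 < nrm (x i) + 1 by have := nrm_ge0 (x i); lra.
have /cvg_normcP/(_ _ (divr_gt0 e2 x0)) := @q_lim i.
apply: filterS2 (ih _ e2) => d r2; rewrite ltr_pdivlMr//= => i2.
have i3 : nrm (((q d).[t i] - w i) *: x i) <= e / 2.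
  by rewrite nrmZ (le_trans _ (ltW i2))// ler_wpM2l ?Defs.normc_ge0// lerDl.
rewrite big_cons (le_lt_trans (nrmD _ _))// [e](splitr e).
by rewrite ler_ltD.
Qed.

Lemma fset_sum_sub (V : zmodType) (A B : {fset I}) (F : I -> V) : (A `<=` B)%fset ->
  \sum_(i <- B) F i - \sum_(i <- A) F i =
  \sum_(i <- [seq i <- B | i \notin A]) F i.
Proof.
move=> /fsubsetP AB; rewrite (bigID (fun i => i \in A))/=.
rewrite -[X in X + _ - _]big_filter -[X in _ + X - _]big_filter.
rewrite (perm_big (A : seq I)); last first.
  apply: uniq_perm; rewrite ?filter_uniq ?fset_uniq// => i.
  by rewrite mem_filter; apply/andb_idr => /AB.
by rewrite addrAC subrr add0r.
Qed.

(** The same [A0] serves the series and the averages; this is what forces their limits to coincide.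
    On the series, the weights have modulus at most 1 and Bessel bounds the tail; on the averages,
    [residual_small] handles what remains after the finitely many eigenvectors. *)
Lemma spectral_tail f (e : R) : 0 < e -> exists A0 : {fset I},
  (forall A : {fset I}, (A0 `<=` A)%fset ->
    nrm (\sum_(i <- A) w i *: P i f - \sum_(i <- A0) w i *: P i f) < e) /\
  \forall d \near \oo, nrm (act U (q d) f - \sum_(i <- A0) w i *: P i f) < e.
Proof.
move=> e0; pose c := nrm f ^+ 2 + 4.
have c4 : 4 <= c by rewrite lerDr sqr_ge0.
(* The bound [a * c] given by [residual_small] then equals half of [(e / 2) ^+ 2]. *)
pose a := (e / 2) ^+ 2 / (2 * c).
have e2 : 0 < e / 2 by lra.
have a0 : 0 < a by rewrite divr_gt0 ?exprn_gt0// mulr_gt0//; lra.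
have ac : a * c < (e / 2) ^+ 2.
  have ac2 : a * (2 * c) = (e / 2) ^+ 2 by rewrite divfK// gt_eqF//; lra.
  have : 0 < a * c by rewrite mulr_gt0//; lra.
  rewrite -ac2 mulrCA; lra.
have ltE (x : H) : nrm x ^+ 2 <= a * c -> nrm x < e / 2.
  move=> xac; rewrite -(@ltr_pXn2r _ 2)// ?nnegrE ?nrm_ge0 ?(ltW e2)//.
  exact: le_lt_trans ac.
have [r ur tail] := exhausting_seq f a0.
pose A0 := [fset i in r]%fset; have A0r i : (i \in A0) = (i \in r) by rewrite inE.
exists A0; split=> [A A0A|].
  rewrite fset_sum_sub//; apply: (@lt_trans _ _ (e / 2)); last by lra.
  apply: ltE; rewrite nrm_proj_sum ?filter_uniq ?fset_uniq//.
  apply: (@le_trans _ _ a); last by rewrite ler_peMr ?(ltW a0)//; lra.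
  apply: le_trans (tail _ (filter_uniq (fun i => i \notin A0) (fset_uniq A)) _);
    last first.
    by move=> i; rewrite mem_filter A0r => /andP[].
  apply: ler_sum => i _; rewrite ler_piMl ?sqr_ge0//.
  by rewrite exprn_ile1 ?Defs.normc_ge0// normc_lim_le1.
rewrite (perm_big r)/=; last first.
  by apply: uniq_perm; rewrite ?fset_uniq// => i; rewrite A0r.
apply: filterS2 (residual_small ur a0 tail) (horner_lim_sum r (P ^~ f) e2) => d.
move=> /ltE res lim; have -> : act U (q d) f - \sum_(i <- r) w i *: P i f =
    act U (q d) (f - \sum_(i <- r) P i f) +
    \sum_(i <- r) ((q d).[t i] - w i) *: P i f.
  have actP : act U (q d) (\sum_(i <- r) P i f) = \sum_(i <- r) (q d).[t i] *: P i f.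
    by rewrite linear_sum; apply: eq_bigr => i _ /=; rewrite (act_eigen _ (P_eigen i f)).
  rewrite (linearB (act U (q d)))/= actP.
  under [X in _ = _ + X]eq_bigr do rewrite scalerBl.
  by rewrite sumrB -addrA addKr.
by rewrite (le_lt_trans (nrmD _ _))// [e](splitr e) ltrD.
Qed.

(** Two late averages are close to the same finite sum, so completeness gives [S]; large partial
    sums are close to that finite sum as well, hence to [S]. *)
Theorem spectral_limit f : exists S : H,
  partial_sum (fun i => w i *: P i f) @ totally --> S /\
  (fun d => act U (q d) f) @ \oo --> S.
Proof.
have [|S Slim] := complH (u := fun d => act U (q d) f).
  move=> e e0; have e2 : 0 < e / 2 by lra.
  have [A [_ [N _ NA]]] := spectral_tail f e2.
  exists N => m n mN nN; set x := \sum_(i <- A) w i *: P i f.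
  rewrite (le_lt_trans (nrm_distD x _ _))// [e](splitr e) ltrD//.
    exact: NA.
  by rewrite nrm_distC; exact: NA.
exists S; split=> //.
have tF : ProperFilter (@totally I) by exact: totally_filter.
apply/cvg_nrmP => e e0; have e3 : 0 < e / 3 by lra.
have [A0 [A0A A0d]] := spectral_tail f e3.
have /cvg_nrmP/(_ _ e3) Sd := Slim.
have [d [/= d1 d2]] := filter_ex (filterI A0d Sd).
exists A0 => // A /= /A0A; rewrite /partial_sum big_seq_fsetE/= => A1.
set x := \sum_(i <- A0) _ in A1 d1; set u := act U _ _ in d1 d2.
have eE : e = e / 3 + (e / 3 + e / 3) by field.
rewrite (le_lt_trans (nrm_distD x _ _))// eE ltrD//.
by rewrite (le_lt_trans (nrm_distD u _ _))// ltrD// nrm_distC.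
Qed.

End spectral_limit.

(** * The polynomials of the averages and their limits at roots of unity *)

Section ip_polynomials.
Context (R : realType) (n : nat -> nat).
Implicit Types (z t : R[i]) (r : seq nat).

Definition ip_poly r : {poly R[i]} := \prod_(j <- r) (2^-1 *: (1 + 'X^(n j))).

Lemma horner_ip_poly r z : (ip_poly r).[z] = \prod_(j <- r) ((1 + z ^+ n j) / 2).
Proof.
rewrite horner_prod; apply: eq_bigr => j _.
by rewrite hornerZ hornerD hornerXn hornerC mulrC.
Qed.

Lemma normc_half_1D z : normc z = 1 -> normc ((1 + z) / 2) <= 1.
Proof.
move=> z1; rewrite normcM normcV normc_nat ler_pdivrMr// mul1r.
by rewrite (le_trans (le_normcD _ _))// normc1 z1 -natr1.
Qed.

(** Here |1 + z|^2 = 2 + 2 Re z, and Re z < 1 at every point of the circle other than 1. *)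
Lemma normc_half_1D_lt z : normc z = 1 -> z != 1 -> normc ((1 + z) / 2) < 1.
Proof.
move=> z1 zn1; rewrite normcM normcV normc_nat ltr_pdivrMr// mul1r.
rewrite -(@ltr_pXn2r _ 2)// ?nnegrE ?Defs.normc_ge0// normc_sqE.
have := normc_sqE z; rewrite z1 expr1n.
case: z zn1 {z1} => a b; rewrite eq_complex /= => zn1 ab.
have b2 : 0 <= b ^+ 2 by exact: sqr_ge0.
have a1 : a < 1.
  have : a <= 1 by rewrite leNgt; apply/negP => a1; nra.
  rewrite le_eqVlt => /orP[/eqP aE|//]; subst a.
  have /eqP : b ^+ 2 = 0 by lra.
  by rewrite sqrf_eq0 => b0; rewrite b0 eqxx in zn1.
nra.
Qed.

Lemma normc_ip_poly_le1 r z : normc z = 1 -> normc (ip_poly r).[z] <= 1.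
Proof.
move=> z1; rewrite horner_ip_poly normc_prod; elim: r => [|j r ih].
  by rewrite big_nil.
rewrite big_cons mulr_ile1 ?Defs.normc_ge0 ?normc_half_1D ?normcX ?z1 ?expr1n//.
by apply: prodr_ge0 => i _; exact: Defs.normc_ge0.
Qed.

Lemma ip_poly_cat m d d' : (m <= d)%N -> (d <= d')%N ->
  ip_poly (index_iota m d') = ip_poly (index_iota m d) * ip_poly (index_iota d d').
Proof. by move=> md dd'; rewrite /ip_poly -big_cat_nat. Qed.

Lemma normc_ip_poly_decr m d d' z : normc z = 1 -> (d <= d')%N ->
  normc (ip_poly (index_iota m d')).[z] <= normc (ip_poly (index_iota m d)).[z].
Proof.
move=> z1 dd'; have [md|/ltnW dm] := leqP m d.
  by rewrite (ip_poly_cat md dd') hornerM normcM ler_piMr ?Defs.normc_ge0//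
    normc_ip_poly_le1.
rewrite [X in _ <= normc X.[z]]/ip_poly big_geq// hornerC normc1.
exact: normc_ip_poly_le1.
Qed.

(** The powers of [t] take only the values with exponent below [b], and the maximum of finitely many
    numbers below 1 is below 1. *)
Lemma root_of_unity_gap t b : normc t = 1 -> (0 < b)%N -> t ^+ b = 1 ->
  exists c : R, [/\ 0 <= c, c < 1 &
    forall k, t ^+ k != 1 -> normc ((1 + t ^+ k) / 2) <= c].
Proof.
move=> t1 b0 tb.
have [c [c0 c1 cP]] : exists c : R, [/\ 0 <= c, c < 1 & forall k, (k < b)%N ->
    t ^+ k != 1 -> normc ((1 + t ^+ k) / 2) <= c].
  elim: b {b0 tb} => [|b [c [c0 c1 cP]]]; first by exists 0; split.
  have [tb|tb] := eqVneq (t ^+ b) 1.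
    exists c; split=> // k; rewrite ltnS leq_eqVlt => /predU1P[->|]; last exact: cP.
    by rewrite tb eqxx.
  exists (Num.max c (normc ((1 + t ^+ b) / 2))); split.
  - by rewrite le_max c0.
  - by rewrite gt_max c1 normc_half_1D_lt// normcX t1 expr1n.
  - move=> k; rewrite ltnS leq_eqVlt => /predU1P[->|kb tk].
      by rewrite le_max lexx orbT.
    by rewrite le_max cP.
exists c; split=> // k; rewrite (divn_eq k b) exprD mulnC exprM tb expr1n mul1r.
by apply: cP; rewrite ltn_pmod.
Qed.

(* Past finitely many j with t^(n j) != 1 the products are constant; otherwise
   infinitely many factors have modulus at most c < 1. *)
Lemma ip_poly_root_cvg t b m : normc t = 1 -> (0 < b)%N -> t ^+ b = 1 ->
  cvg ((ip_poly (index_iota m d)).[t] @[d --> \oo]).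
Proof.
move=> t1 b0 tb; have [c [c0 c1 cP]] := root_of_unity_gap t1 b0 tb.
have [[N NP]|inf] := pselect (exists N, forall j, (N <= j)%N -> t ^+ n j = 1).
  apply/cvg_ex; exists (ip_poly (index_iota m (maxn m N))).[t].
  apply/cvg_normcP => e e0; exists (maxn m N) => // d /= Nd.
  rewrite (ip_poly_cat (leq_maxl m N) Nd) hornerM [X in _ * X]horner_ip_poly.
  rewrite big_nat big1 ?mulr1 ?subrr ?normc0// => j /andP[Nj _].
  rewrite NP; last by rewrite (leq_trans (leq_maxr m N)).
  by rewrite -mulr2n mulfV// pnatr_eq0.
apply/cvg_ex; exists 0; apply/cvg_normcP => e e0.
(* Indices with [t ^+ n j != 1] exist beyond any bound, and each one gains another factor [c]. *)
have pow K : exists2 d0, (m <= d0)%N & forall d, (d0 <= d)%N ->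
    normc (ip_poly (index_iota m d)).[t] <= c ^+ K.
  elim: K => [|K [d0 md0 ih]].
    by exists m => // d _; rewrite expr0 normc_ip_poly_le1.
  have [j d0j tj] : exists2 j, (d0 <= j)%N & t ^+ n j != 1.
    apply: contrapT => no; apply: inf; exists d0 => j d0j.
    by apply: contrapT => /eqP tj; apply: no; exists j.
  have mj : (m <= j)%N := leq_trans md0 d0j.
  exists j.+1 => [|d jd]; first exact: leqW.
  rewrite (le_trans (normc_ip_poly_decr m t1 jd))//.
  rewrite (ip_poly_cat mj (leqnSn j)) hornerM normcM exprSr.
  rewrite ler_pM ?Defs.normc_ge0 ?ih// horner_ip_poly big_nat1; exact: cP.
have cn : `|c| < 1 by rewrite ger0_norm.
have /cvgrPdist_lt/(_ _ e0)/filter_ex[K] := cvg_expr cn.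
rewrite sub0r normrN normrX ger0_norm// => cK.
have [d0 _ d0P] := pow K.
exists d0 => // d /d0P; rewrite subr0 => /le_lt_trans; exact.
Qed.

Lemma expi_intN (x : R) : expi (- x) * expi x = 1.
Proof. by rewrite -expiD addNr expi0. Qed.

Lemma expi_int (k : int) : expi (k%:~R : R) = 1.
Proof.
case: k => k; first by rewrite -pmulrn expi_nat.
by have := expi_intN (k.+1%:R : R); rewrite expi_nat mulr1 NegzE mulrNz -pmulrn.
Qed.

Lemma rational_circle_root t : rational_circle t ->
  normc t = 1 /\ exists2 b, (0 < b)%N & t ^+ b = 1.
Proof.
move=> [x _ <-]; rewrite -/(expi _); split; first exact: normc_expi.
exists `|denq x|%N; first by rewrite absz_gt0 denq_neq0.
rewrite expiX.
suff -> : `|denq x|%N%:R * ratr x = (numq x)%:~R :> R by exact: expi_int.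
rewrite natr_absz ger0_norm ?denq_ge0//.
by rewrite /ratr mulrCA mulfV ?mulr1// intr_eq0 denq_neq0.
Qed.

Lemma folner_perm (Phi : nat -> {fset nat}) M (a : nat -> nat) N :
  (forall N j, (j \in Phi N) = (M <= j <= a N)%N) ->
  perm_eq (Phi N) (index_iota M (a N).+1).
Proof.
move=> PhiE; apply: uniq_perm; rewrite ?fset_uniq ?iota_uniq// => j.
by rewrite PhiE mem_index_iota ltnS.
Qed.

(** Expanding the product chooses a subset [F]; subsets with equal sums give separate terms, which
    is the multiplicity in the IP average. The induction splits the subsets by whether they contain
    [x]. *)
Lemma ip_sum_poly (A : {fset nat}) :
  \prod_(j <- A) (1 + 'X^(n j)) =
  \sum_(F <- fpowerset A) 'X^(ip_sum n F) :> {poly R[i]}.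
Proof.
elim/fset1U_rect: A => [|x B xB ih].
  by rewrite fpowerset0 !big_seq_fset1 /ip_sum !big_seq_fset0 expr0.
have notin F : F \in fpowerset B -> x \notin F.
  by rewrite fpowersetE => /fsubsetP FB; apply: contraNN xB; exact: FB.
have powE : perm_eq (fpowerset (x |` B)%fset)
    (fpowerset B ++ [seq (x |` F)%fset | F <- fpowerset B]).
  apply: uniq_perm; first exact: fset_uniq.
    rewrite cat_uniq fset_uniq map_inj_in_uniq ?fset_uniq ?andbT//=.
      apply/hasPn => _ /mapP[F _ ->]; apply/negP => /notin.
      by rewrite fset1U1.
    move=> F G /notin xF /notin xG FG.
    by rewrite -(fsetU1K xF) FG fsetU1K.
  move=> F; rewrite mem_cat fpowersetE; apply/idP/orP.
    move=> FxB; case xF: (x \in F); last first.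
      left; rewrite fpowersetE; apply/fsubsetP => y yF.
      have := fsubsetP FxB y yF; rewrite in_fset1U => /predU1P[yx|//].
      by rewrite -yx yF in xF.
    right; apply/mapP; exists (F `\ x)%fset; last by rewrite fsetD1K.
    by rewrite fpowersetE fsubDset.
  case=> [|/mapP[G]]; rewrite fpowersetE; last first.
    by move=> GB ->; exact: fsetUS.
  by move=> FB; exact: fsubset_trans FB (fsubsetU1 _ _).
rewrite (perm_big _ powE) big_cat big_map/= -ih big_fsetU1//=.
rewrite mulrDl mul1r; congr (_ + _); rewrite ih mulr_sumr big_seq [RHS]big_seq.
apply: eq_bigr => F /notin xF.
by rewrite /ip_sum big_fsetU1//= exprD.
Qed.

Lemma ip_avg_act (H : normedModType R[i]) (U : {linear H -> H}) (A : {fset nat}) f :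
  ip_avg n A (fun k : nat => iter k U) f = act U (ip_poly A) f.
Proof.
rewrite /ip_poly scaler_prod ip_sum_poly actZl act_suml.
rewrite big_const_seq count_predT iter_mulr mulr1 exprVn.
rewrite /ip_avg; congr (_ *: _).
rewrite fct_sumE; apply: eq_bigr => F _; by rewrite actXn.
Qed.

End ip_polynomials.

(** * [L2] as an inner product space *)

Section L2_inner_product.
Context d (T : measurableType d) (R : realType).
Variable mu : {measure set T -> \bar R}.
Implicit Types f g h : T -> R[i].

Lemma cmeasurable_normc_sq f : cmeasurable f ->
  measurable_fun [set: T] (fun x => (normc (f x) ^+ 2)%:E : \bar R).
Proof.
move=> mf; apply/measurable_EFinP/measurable_funX; exact: cmeasurable_normc.
Qed.

Lemma cLnorm2_integral f :
  cLnorm2 mu f = ((\int[mu]_x (normc (f x) ^+ 2)%:E) `^ 2^-1)%E.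
Proof.
rewrite cLnorm2E; congr (_ `^ _)%E; apply: eq_integral => x _.
by rewrite powR_mulrn ?Defs.normc_ge0.
Qed.

Lemma integral_normc_sq_ge0 f : (0 <= \int[mu]_x (normc (f x) ^+ 2)%:E)%E.
Proof. by apply: integral_ge0 => x _; rewrite lee_fin sqr_ge0. Qed.

Lemma cLnorm2_lty f :
  (cLnorm2 mu f < +oo)%E <-> (\int[mu]_x (normc (f x) ^+ 2)%:E < +oo)%E.
Proof.
rewrite cLnorm2_integral; have := integral_normc_sq_ge0 f.
case: (\int[mu]_x _)%E => [r r0|_|//]; first by rewrite poweR_EFin !ltry.
by rewrite poweRyr ?invr_eq0 ?pnatr_eq0.
Qed.

Lemma integral_normc_sq f : (cLnorm2 mu f < +oo)%E ->
  (\int[mu]_x (normc (f x) ^+ 2)%:E = (fine (cLnorm2 mu f) ^+ 2)%:E)%E.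
Proof.
move=> /cLnorm2_lty; rewrite cLnorm2_integral; have := integral_normc_sq_ge0 f.
case: (\int[mu]_x _)%E => [r r0 _|//|//]; rewrite lee_fin in r0.
by rewrite poweR_EFin/= powR12_sqrt// sqr_sqrtr.
Qed.

Definition cintegrable h := mu.-integrable setT (EFin \o (@complex.Re R \o h)) /\
  mu.-integrable setT (EFin \o (@complex.Im R \o h)).

Lemma normc_Re_le (z : R[i]) : `|complex.Re z| <= normc z.
Proof. by rewrite -lecR -normrc normc_ge_Re. Qed.

Lemma normc_Im_le (z : R[i]) : `|complex.Im z| <= normc z.
Proof.
by rewrite -sqrtr_sqr; case: z => a b /=; rewrite ler_wsqrtr// lerDr sqr_ge0.
Qed.

Lemma cmeasurableM_conj f g : cmeasurable f -> cmeasurable g ->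
  cmeasurable (fun x => f x * conjc (g x)).
Proof.
move=> [fr fi] [gr gi]; split.
  have -> : @complex.Re R \o (fun x => f x * conjc (g x)) =
      (fun x => complex.Re (f x) * complex.Re (g x) +
                complex.Im (f x) * complex.Im (g x)).
    by apply/funext => x /=; case: (f x) => a b; case: (g x) => a' b' /=; ring.
  by apply: measurable_funD; exact: measurable_funM.
have -> : @complex.Im R \o (fun x => f x * conjc (g x)) =
    (fun x => complex.Im (f x) * complex.Re (g x) -
              complex.Re (f x) * complex.Im (g x)).
  by apply/funext => x /=; case: (f x) => a b; case: (g x) => a' b' /=; ring.
by apply: measurable_funB; exact: measurable_funM.
Qed.

Lemma integrable_normc_sq f : cmeasurable f -> (cLnorm2 mu f < +oo)%E ->
  mu.-integrable setT (fun x => (normc (f x) ^+ 2)%:E : \bar R).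
Proof.
move=> mf lf; apply/integrableP; split; first exact: cmeasurable_normc_sq.
under eq_integral do rewrite gee0_abs ?lee_fin ?sqr_ge0//.
by move/cLnorm2_lty : lf.
Qed.

Lemma cintegrable_conj f g : cmeasurable f -> cmeasurable g ->
  (cLnorm2 mu f < +oo)%E -> (cLnorm2 mu g < +oo)%E ->
  cintegrable (fun x => f x * conjc (g x)).
Proof.
move=> mf mg lf lg; have [mr mi] := cmeasurableM_conj mf mg.
have ifg := integrableD measurableT (integrable_normc_sq mf lf)
  (integrable_normc_sq mg lg).
(* Expanding (a - b)^2 >= 0 for the two moduli replaces Hölder's inequality. *)
have le x : normc (f x * conjc (g x)) <= normc (f x) ^+ 2 + normc (g x) ^+ 2.
  rewrite normcM normc_conj.
  have := sqr_ge0 (normc (f x) - normc (g x)).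
  have := mulr_ge0 (Defs.normc_ge0 (f x)) (Defs.normc_ge0 (g x)).
  rewrite sqrrB -mulr_natl; lra.
have le2 x : normc (f x * conjc (g x)) <= `|normc (f x) ^+ 2 + normc (g x) ^+ 2|.
  by rewrite ger0_norm// addr_ge0 ?sqr_ge0.
split; apply: le_integrable ifg => //; try exact/measurable_EFinP;
  move=> x _; rewrite -EFinD !abse_EFin lee_fin /= (le_trans _ (le2 x))//.
  exact: normc_Re_le.
exact: normc_Im_le.
Qed.

Lemma cintegral_ae f g : cmeasurable f -> cmeasurable g ->
  {ae mu, forall x, f x = g x} -> cintegral mu f = cintegral mu g.
Proof.
move=> [mfr mfi] [mgr mgi] fg; congr (_ +i* _); congr fine;
  apply: ae_eq_integral => //; try exact/measurable_EFinP;
  by apply: filterS fg => x /= ->.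
Qed.

Lemma cintegralD f g : cintegrable f -> cintegrable g ->
  cintegral mu (fun x => f x + g x) = cintegral mu f + cintegral mu g.
Proof.
move=> [fr fi] [gr gi]; apply/eqP; rewrite eq_complex; apply/andP; split; apply/eqP.
  rewrite /= -RintegralD//; apply: eq_Rintegral => x _ /=.
  by case: (f x); case: (g x).
rewrite /= -RintegralD//; apply: eq_Rintegral => x _ /=.
by case: (f x); case: (g x).
Qed.

Lemma integrableZ (r : R) (u : T -> R) : mu.-integrable setT (EFin \o u) ->
  mu.-integrable setT (EFin \o (fun x => r * u x)).
Proof. by move=> /(integrableZl measurableT r). Qed.

Lemma cintegralZ (a : R[i]) f : cintegrable f ->
  cintegral mu (fun x => a * f x) = a * cintegral mu f.
Proof.
case: a => a b [fr fi]; apply/eqP; rewrite eq_complex; apply/andP.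
have [afr bfr] := (integrableZ a fr, integrableZ b fr).
have [afi bfi] := (integrableZ a fi, integrableZ b fi).
split; apply/eqP; rewrite /= -!RintegralZl//.
  rewrite -RintegralB//; apply: eq_Rintegral => x _ /=; by case: (f x).
rewrite -RintegralD//; apply: eq_Rintegral => x _ /=; by case: (f x).
Qed.

Lemma cintegral_conj f : cintegrable f ->
  cintegral mu (fun x => conjc (f x)) = conjc (cintegral mu f).
Proof.
move=> [fr fi]; apply/eqP; rewrite eq_complex; apply/andP; split; apply/eqP => /=.
  by apply: eq_Rintegral => x _ /=; case: (f x).
rewrite -mulN1r -RintegralZl//; apply: eq_Rintegral => x _ /=.
by rewrite mulN1r; case: (f x).
Qed.

Lemma L2_innerE (f g : L2 mu) :
  L2_inner f g = cintegral mu (fun x => of_L2 f x * conjc (of_L2 g x)).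
Proof. by []. Qed.

Lemma L2_inner_is_inner_product : inner_product (@L2_inner d T R mu).
Proof.
have M (f : L2 mu) : cmeasurable (of_L2 f) by case: (L2funP (of_L2 f)).
have L (f : L2 mu) : (cLnorm2 mu (of_L2 f) < +oo)%E by case: (L2funP (of_L2 f)).
have I (f g : L2 mu) : cintegrable (fun x => of_L2 f x * conjc (of_L2 g x)).
  exact: cintegrable_conj.
split.
- move=> a f g h; rewrite !L2_innerE -cintegralZ// -cintegralD//; last first.
    have -> : (fun x => a * (of_L2 f x * conjc (of_L2 h x))) =
        (fun x => (a *: (of_L2 f : T -> R[i])) x * conjc (of_L2 h x)).
      by apply/funext => x; rewrite mulrA.
    apply: cintegrable_conj => //; first exact: cmeasurableZ.
    by rewrite cLnorm2Z// lte_mul_pinfty// ?lee_fin ?Defs.normc_ge0.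
  (* The chosen representatives are linear in the class only almost everywhere. *)
  apply: cintegral_ae; first exact: cmeasurableM_conj.
    have -> : (fun x => a * (of_L2 f x * conjc (of_L2 h x)) +
        of_L2 g x * conjc (of_L2 h x)) =
        (fun x => (a *: (of_L2 f : T -> R[i]) + of_L2 g) x * conjc (of_L2 h x)).
      by apply/funext => x; rewrite mulrA -mulrDl.
    apply: cmeasurableM_conj => //.
    by apply: cmeasurableD => //; exact: cmeasurableZ.
  apply: filterS2 (of_L2D (a *: f) g) (to_L2K (a *: of_L2 f)) => x -> ->.
  by rewrite mulrDl -mulrA.
- move=> f g; rewrite !L2_innerE -cintegral_conj//; congr cintegral.
  by apply/funext => x; rewrite rmorphM/= conjcK mulrC.
- move=> f.
  have -> : `|f| ^+ 2 = (fine (cLnorm2 mu (of_L2 f)) ^+ 2)%:C by rewrite rmorphXn.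
  rewrite L2_innerE; apply/eqP; rewrite eq_complex; apply/andP; split; apply/eqP => /=.
    rewrite -[RHS]/(fine (fine (cLnorm2 mu (of_L2 f)) ^+ 2)%:E) -integral_normc_sq//.
    congr fine; apply: eq_integral => x _; congr EFin => /=.
    by rewrite -normc_sqr.
  transitivity (Rintegral mu setT (cst 0)); last by rewrite Rintegral_cst ?mul0r.
  by apply: eq_Rintegral => x _ /=; rewrite -normc_sqr.
Qed.

End L2_inner_product.

(** * Completeness of [L2], after Riesz and Fischer *)

Section limits.
Context (R : realType).

(* The hypothesis is the absolute convergence of the telescoping series. *)
Lemma telescope_cvg (u : nat -> R) (b : nat -> R) :
  (forall k, 0 <= b k) -> (\sum_(0 <= k <oo) (b k)%:E)%E \is a fin_num ->
  (forall k, `|u k.+1 - u k| <= b k) -> cvgn u.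
Proof.
move=> b0 bfin ub.
have cb : cvgn (series b).
  apply: nondecreasing_is_cvgn; first exact: nondecreasing_series.
  exists (fine (\sum_(0 <= k <oo) (b k)%:E)%E) => _ [n _ <-].
  rewrite -lee_fin fineK// /series/= -sumEFin.
  by apply: nneseries_lim_ge => k _ _; rewrite lee_fin.
have /normed_cvg : cvgn [normed series (telescope u)].
  by apply: (@series_le_cvg R _ b) => // n; exact: normr_ge0.
rewrite telescopeK => /cvg_ex[l ul]; apply/cvg_ex; exists (l + u 0%N).
apply: cvg_trans (cvgD ul (cvg_cst (u 0%N))).
by apply: near_eq_cvg; apply: nearW => n; exact: subrK.
Qed.

Lemma limn_einf_le_near (u : nat -> \bar R) c :
  (\forall n \near \oo, (u n <= c)%E) -> (limn_einf u <= c)%E.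
Proof.
move=> [N _ uc]; rewrite limn_einf_lim; apply: lime_le; first exact: is_cvg_einfs.
apply: nearW => n; apply: (@le_trans _ _ (u (maxn n N))).
  by apply: ereal_inf_lbound; exists (maxn n N) => //=; exact: leq_maxl.
by apply: uc => /=; exact: leq_maxr.
Qed.

End limits.

Section L2_complete.
Context d (T : measurableType d) (R : realType).
Variable mu : {measure set T -> \bar R}.

Lemma nrm_L2_sub (f g : L2fun mu) :
  (\int[mu]_x (normc (f x - g x) ^+ 2)%:E = (nrm (to_L2 f - to_L2 g) ^+ 2)%:E)%E.
Proof.
have -> : to_L2 f - to_L2 g = to_L2 (f - g).
  by apply/eqP; rewrite subr_eq -to_L2D subrK.
have -> : nrm (to_L2 (f - g)) = fine (cLnorm2 mu (f - g)).
  transitivity (complex.Re (L2_norm (to_L2 (f - g)))); first by [].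
  by rewrite L2_norm_to_L2.
by rewrite -integral_normc_sq//; case: (L2funP (f - g)).
Qed.

Lemma square_integrable_of_sub (f : L2fun mu) (G : T -> R[i]) : cmeasurable G ->
  (\int[mu]_x (normc (f x - G x) ^+ 2)%:E < +oo)%E -> G \in square_integrable mu.
Proof.
move=> mG fG; have [mf lf] := L2funP f.
have -> : G = (f : T -> R[i]) + (-1) *: ((f : T -> R[i]) + (-1) *: G).
  by apply/funext => x; rewrite !fctE /= !scaleN1r opprB addrC subrK.
have fS : (f : T -> R[i]) \in square_integrable mu by apply/asboolP.
suff gS : ((f : T -> R[i]) + (-1) *: G) \in square_integrable mu.
  by rewrite addrC; have [_ ->] := square_integrable_submod_closed mu.
apply/asboolP; split; first exact/cmeasurableD/cmeasurableZ.
apply/cLnorm2_lty; congr (_ < _)%E: fG; apply: eq_integral => x _.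
by rewrite !fctE scaleN1r.
Qed.

Hypothesis mu_fin : (mu setT < +oo)%E.

Section rapidly_cauchy.
Variable v : nat -> L2fun mu.
Local Notation b k := (2^-1 ^+ k : R).
Hypothesis vb : forall k, nrm (to_L2 (v k.+1) - to_L2 (v k)) <= b k.
Let D k x := normc (v k.+1 x - v k x).

Let cmv k : cmeasurable (v k). Proof. by case: (L2funP (v k)). Qed.

Let cmeasurable_sub (F G : T -> R[i]) : cmeasurable F -> cmeasurable G ->
  cmeasurable (fun x => F x - G x).
Proof.
move=> mF mG; have -> : (fun x => F x - G x) = F + (-1) *: G.
  by apply/funext => x; rewrite !fctE scaleN1r.
exact/cmeasurableD/cmeasurableZ.
Qed.

Let mD k : measurable_fun setT (D k).
Proof. by apply: cmeasurable_normc; exact: cmeasurable_sub. Qed.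

Let b_gt0 k : 0 < b k. Proof. by rewrite exprn_gt0. Qed.

(** Pointwise D <= D^2 / b + b, from (D - b)^2 >= 0. The integral of D^2 is at most b^2, and that of
    the constant b is finite because the measure is: this passes from square integrals to
    integrals. *)
Lemma integral_increment_le k :
  (\int[mu]_x (D k x)%:E <= (b k * (1 + fine (mu setT)))%:E)%E.
Proof.
pose a := (b k)^-1; have a0 : 0 < a by rewrite invr_gt0.
have sq0 x : (0 <= (D k x ^+ 2)%:E)%E by rewrite lee_fin sqr_ge0.
have msq : measurable_fun setT (fun x => (D k x ^+ 2)%:E).
  by apply/measurable_EFinP/measurable_funX.
apply: (@le_trans _ _ (\int[mu]_x (a%:E * (D k x ^+ 2)%:E + (b k)%:E))%E).
  apply: ge0_le_integral => //.
  - by move=> x _; rewrite lee_fin Defs.normc_ge0.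
  - exact/measurable_EFinP.
  - apply: emeasurable_funD => //; exact: measurable_funeM.
  move=> x _; rewrite -EFinM -EFinD lee_fin.
  have : 0 <= a * (D k x - b k) ^+ 2 by rewrite mulr_ge0 ?sqr_ge0// ltW.
  have -> : a * (D k x - b k) ^+ 2 = a * D k x ^+ 2 - 2 * D k x + b k.
    by rewrite /a; field; rewrite gt_eqF.
  have : 0 <= D k x by exact: Defs.normc_ge0.
  lra.
have a_sq0 x : (0 <= a%:E * (D k x ^+ 2)%:E)%E by rewrite mule_ge0// lee_fin ltW.
have ma_sq : measurable_fun setT (fun x => a%:E * (D k x ^+ 2)%:E)%E.
  exact: measurable_funeM.
rewrite ge0_integralD//.
rewrite ge0_integralZl_EFin ?(ltW a0)// nrm_L2_sub integral_cst//.
rewrite -(@fineK _ (mu setT)) ?ge0_fin_numE// -!EFinM -EFinD lee_fin.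
rewrite [leRHS]mulrDr mulr1 lerD2r ler_pdivrMl//.
by rewrite -expr2 lerXn2r ?nnegrE ?nrm_ge0// ltW.
Qed.

(** The integrals of the increments are dominated by a geometric series, so the sum of the
    increments is integrable and thus almost everywhere finite. *)
Lemma increments_summable_ae :
  {ae mu, forall x, (\sum_(0 <= k <oo) (D k x)%:E)%E \is a fin_num}.
Proof.
have D0 k x : (0 <= (D k x)%:E)%E by rewrite lee_fin Defs.normc_ge0.
have mDE k : measurable_fun setT (fun x => (D k x)%:E) by exact/measurable_EFinP.
have mS : measurable_fun setT (fun x => \sum_(0 <= k <oo) (D k x)%:E)%E.
  exact: ge0_emeasurable_sum.
have : mu.-integrable setT (fun x => \sum_(0 <= k <oo) (D k x)%:E)%E.
  apply/integrableP; split=> //.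
  under eq_integral => x _ do rewrite gee0_abs ?nneseries_ge0//.
  rewrite integral_nneseries//.
  pose r := 2 * (1 + fine (mu setT)).
  apply: (@le_lt_trans _ _ (\sum_(0 <= k <oo) (r / (2 ^ (k + 1))%:R)%:E)%E).
    apply: lee_nneseries => [k _ _|k _]; first exact: integral_ge0.
    rewrite (le_trans (integral_increment_le k))// lee_fin /r.
    rewrite addn1 expnS natrM natrX invfM mulrACA mulfV ?mul1r ?pnatr_eq0//.
    by rewrite mulrC exprVn.
  have /cvg_lim := @cvg_geometric_eseries_half R r 0.
  by rewrite /eseries/= => -> //; exact: ltry.
by move=> /(integrable_ae measurableT); apply: filterS => x; exact.
Qed.

(** Upper limits are defined and measurable everywhere, and agree with the limits almost everywhere;
    [fine] sends infinite values to 0. *)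
Let G x : R[i] :=
  fine (limn_esup (fun k => (complex.Re (v k x))%:E)) +i*
  fine (limn_esup (fun k => (complex.Im (v k x))%:E)).

Let mG : cmeasurable G.
Proof.
by split; apply: (measurableT_comp (fine_measurable measurableT));
  apply: measurable_fun_limn_esup => k; apply/measurable_EFinP; case: (cmv k).
Qed.

Lemma rapidly_cauchy_cvg_ae : {ae mu, forall x,
  complex.Re (v k x) @[k --> \oo] --> complex.Re (G x) /\
  complex.Im (v k x) @[k --> \oo] --> complex.Im (G x)}.
Proof.
apply: filterS increments_summable_ae => x Dx.
have D0 k : 0 <= D k x by exact: Defs.normc_ge0.
split.
  have /cvg_ex[l ul] : cvgn (fun k => complex.Re (v k x)).
    apply: telescope_cvg D0 Dx _ => k.
    rewrite (le_trans _ (normc_Re_le _))//.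
    by case: (v k.+1 x) => ? ?; case: (v k x).
  have /cvg_limn_einf_sup[_ supE] : (complex.Re (v k x))%:E @[k --> \oo] --> l%:E.
    by apply: cvg_EFin => //; exact: nearW.
  by rewrite /G supE.
have /cvg_ex[l ul] : cvgn (fun k => complex.Im (v k x)).
  apply: telescope_cvg D0 Dx _ => k.
  rewrite (le_trans _ (normc_Im_le _))//.
  by case: (v k.+1 x) => ? ?; case: (v k x).
have /cvg_limn_einf_sup[_ supE] : (complex.Im (v k x))%:E @[k --> \oo] --> l%:E.
  by apply: cvg_EFin => //; exact: nearW.
by rewrite /G supE.
Qed.

Lemma nrm_rapidly_cauchy k m : nrm (to_L2 (v k) - to_L2 (v (k + m))) <= 2 * b k.
Proof.
(* Subtracting [2 * b (k + m)] makes the induction close: the next increment is at most [b (k + m)],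
   the amount by which the bound grows. *)
suff : nrm (to_L2 (v k) - to_L2 (v (k + m))) <= 2 * b k - 2 * b (k + m).
  have := b_gt0 (k + m); lra.
elim: m => [|m ih]; first by rewrite addn0 subrr nrm0 subrr.
rewrite addnS (le_trans (nrm_distD (to_L2 (v (k + m))) _ _))//.
have := vb (k + m); rewrite (nrm_distC (to_L2 (v (k + m)))) exprS.
have : 2 * (2^-1 * b (k + m)) = b (k + m) by rewrite mulrA mulfV ?mul1r ?pnatr_eq0.
lra.
Qed.

(** Fatou's lemma applied to the squares of [v k - v m] as [m] grows, with [nrm_rapidly_cauchy]
    bounding each integral. *)
Lemma rapidly_cauchy_fatou k :
  (\int[mu]_x (normc (v k x - G x) ^+ 2)%:E <= ((2 * b k) ^+ 2)%:E)%E.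
Proof.
pose F m x := (normc (v k x - v m x) ^+ 2)%:E.
have mF m : measurable_fun setT (F m).
  by apply: cmeasurable_normc_sq; exact: cmeasurable_sub.
have F0 m x : (0 <= F m x)%E by rewrite lee_fin sqr_ge0.
have -> : (\int[mu]_x (normc (v k x - G x) ^+ 2)%:E =
    \int[mu]_x limn_einf (F ^~ x))%E.
  apply: ge0_ae_eq_integral => //.
  - by apply: cmeasurable_normc_sq; exact: cmeasurable_sub.
  - rewrite [X in measurable_fun _ X](_ : _ = fun x =>
        (- limn_esup (fun m => - F m x))%E); last first.
      apply/funext => x; rewrite -limn_einfN; congr limn_einf.
      by apply/funext => m; exact/esym/oppeK.
    apply: (measurableT_comp (f := -%E)) => //.
    apply: measurable_fun_limn_esup => m.
    exact: (measurableT_comp (f := -%E)).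
  - by move=> x _; rewrite lee_fin sqr_ge0.
  - move=> x _; rewrite limn_einf_lim; apply: lime_ge; first exact: is_cvg_einfs.
    apply: nearW => m; apply: le_ereal_inf_tmp => _ [j _ <-]; exact: F0.
  apply: filterS rapidly_cauchy_cvg_ae => x [ReG ImG] _.
  apply/esym/(cvg_limn_einf_sup _).1.
  apply: cvg_EFin; first exact: nearW.
  rewrite [X in X @ _ --> _](_ : _ = fun m =>
    (complex.Re (v k x) - complex.Re (v m x)) *
    (complex.Re (v k x) - complex.Re (v m x)) +
    (complex.Im (v k x) - complex.Im (v m x)) *
    (complex.Im (v k x) - complex.Im (v m x))); last first.
    apply/funext => m /=; rewrite normc_sqE !expr2.
    by case: (v k x) => ? ?; case: (v m x).
  rewrite normc_sqE !expr2.
  have -> : complex.Re (v k x - G x) = complex.Re (v k x) - complex.Re (G x).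
    by case: (v k x) => ? ?; case: (G x).
  have -> : complex.Im (v k x - G x) = complex.Im (v k x) - complex.Im (G x).
    by case: (v k x) => ? ?; case: (G x).
  have ReC : complex.Re (v k x) - complex.Re (v m x) @[m --> \oo] -->
      complex.Re (v k x) - complex.Re (G x).
    by apply: cvgB; [exact: cvg_cst|].
  have ImC : complex.Im (v k x) - complex.Im (v m x) @[m --> \oo] -->
      complex.Im (v k x) - complex.Im (G x).
    by apply: cvgB; [exact: cvg_cst|].
  by apply: cvgD; apply: cvgM.
apply: (le_trans (fatou mu measurableT mF (fun m x _ => F0 m x))).
apply: limn_einf_le_near; exists k => // m /= km.
rewrite /F nrm_L2_sub lee_fin lerXn2r ?nnegrE ?nrm_ge0 ?mulr_ge0 ?(ltW (b_gt0 k))//.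
by rewrite -(subnKC km) nrm_rapidly_cauchy.
Qed.

Lemma rapidly_cauchy_limit :
  exists l : L2 mu, forall k, nrm (to_L2 (v k) - l) <= 2 * b k.
Proof.
have GS : G \in square_integrable mu.
  apply: (square_integrable_of_sub (f := v 0)) => //.
  by rewrite (le_lt_trans (rapidly_cauchy_fatou 0))// ltry.
exists (to_L2 (mkL2fun GS)) => k.
have := rapidly_cauchy_fatou k; rewrite -[G]/(mkL2fun GS : T -> R[i]).
rewrite nrm_L2_sub lee_fin ler_pXn2r ?nnegrE ?nrm_ge0 ?mulr_ge0 ?(ltW (b_gt0 k))//.
Qed.

End rapidly_cauchy.

Theorem L2_complete : sequentially_complete (L2 mu).
Proof.
move=> u uC.
have /choice[N NP] k : exists N, forall m n, (N <= m)%N -> (N <= n)%N ->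
    nrm (u m - u n) < 2^-1 ^+ k by apply: uC; rewrite exprn_gt0.
(* Summing the thresholds gives indices that are nondecreasing and at least [N k], so consecutive
   terms of the subsequence differ by less than [2^-1 ^+ k]. *)
pose phi k := (\sum_(i < k.+1) N i)%N.
have Nphi k : (N k <= phi k)%N by rewrite /phi big_ord_recr leq_addl.
have phiS k : (phi k <= phi k.+1)%N by rewrite [X in (_ <= X)%N]/phi big_ord_recr leq_addr.
have [k|l lP] := rapidly_cauchy_limit (v := fun k => of_L2 (u (phi k))).
  by rewrite !of_L2K ltW// NP// (leq_trans (Nphi k)).
exists l; apply/cvg_nrmP => e e0.
have h1 : `|2^-1 : R| < 1 by rewrite ger0_norm// invf_lt1// ltr1n.
have e3 : 0 < e / 3 by lra.
have /cvgrPdist_lt/(_ _ e3)/filter_ex[k] := cvg_expr h1.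
rewrite sub0r normrN ger0_norm ?exprn_ge0// => ke.
exists (N k) => // n /= Nn.
rewrite (le_lt_trans (nrm_distD (u (phi k)) _ _))//.
have := lP k; rewrite of_L2K; have := NP k n (phi k) Nn (Nphi k); lra.
Qed.

End L2_complete.

(** * The Koopman operator and its eigenprojections *)

Section koopman_isometry.
Context d (X : measurableType d) (R : realType).
Context (mu : {measure set X -> \bar R}) (T : invertible_mpt mu).

Lemma ae_mpt (Q : X -> Prop) :
  {ae mu, forall x, Q x} -> {ae mu, forall x, Q (T x)}.
Proof.
move=> [A [mA A0 QA]]; exists (T @^-1` A); split.
- by rewrite -[X in measurable X]setTI; exact: (measurable_mpt_fun T).
- by rewrite mpt_preserving.
- by move=> x /= nQ; apply: QA.
Qed.

Lemma integral_mpt (f : X -> \bar R) : measurable_fun setT f ->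
  (\int[mu]_x f (T x) = \int[mu]_x f x)%E.
Proof.
move=> mf; have mT := measurable_mpt_fun T.
have ge0 (g : X -> \bar R) : measurable_fun setT g -> (forall x, 0 <= g x)%E ->
    (\int[mu]_x (g \o T) x = \int[mu]_x g x)%E.
  move=> mg g0; have := ge0_integral_pushforward mT mu measurableT mg.
  rewrite preimage_setT => <-; last by move=> x _; exact: g0.
  by apply: eq_measure_integral => A mA _; exact: (mpt_preserving T mA).
rewrite -[LHS]/(\int[mu]_x (f \o T) x)%E integralE [RHS]integralE.
rewrite funepos_comp funeneg_comp !ge0//.
- exact: measurable_funeneg.
- exact: measurable_funepos.
Qed.

(** Independence of the representative: [T] pulls null sets back to null sets. *)
Lemma koopman_to_L2 (F : L2fun mu) :
  koopman T (to_L2 F) = to_L2 (mkL2fun (square_integrable_mpt T F)).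
Proof. by apply/to_L2P; exact: ae_mpt (to_L2K F). Qed.

Fact koopman_linear : linear (koopman T).
Proof.
move=> a f g; rewrite -[f]of_L2K -[g]of_L2K.
rewrite -[a *: to_L2 _]/(L2_scale _ _) -to_L2Z -to_L2D !koopman_to_L2.
rewrite -[a *: to_L2 _]/(L2_scale _ _) -to_L2Z -to_L2D.
by apply/to_L2P; apply: nearW.
Qed.

HB.instance Definition _ :=
  GRing.isLinear.Build R[i] (L2 mu) (L2 mu) *:%R (koopman T) koopman_linear.

Lemma koopman_isometry (f g : L2 mu) :
  L2_inner (koopman T f) (koopman T g) = L2_inner f g.
Proof.
have M (h : L2 mu) : cmeasurable (of_L2 h) by case: (L2funP (of_L2 h)).
have mfg := cmeasurableM_conj (M f) (M g).
have mT := measurable_mpt_fun T.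
have mfgT : cmeasurable (fun x => of_L2 f (T x) * conjc (of_L2 g (T x))).
  by case: mfg => mr mi; split;
    [exact: (measurableT_comp mr mT)|exact: (measurableT_comp mi mT)].
rewrite !L2_innerE.
rewrite (cintegral_ae (cmeasurableM_conj (M _) (M _)) mfgT); last first.
  apply: filterS2 (to_L2K (mkL2fun (square_integrable_mpt T (of_L2 f))))
    (to_L2K (mkL2fun (square_integrable_mpt T (of_L2 g)))) => x fx gx.
  by rewrite /koopman fx gx.
case: mfg => mr mi; congr (_ +i* _); congr fine.
  exact: (integral_mpt ((measurable_EFinP _ _).2 mr)).
exact: (integral_mpt ((measurable_EFinP _ _).2 mi)).
Qed.

Hypothesis mu_fin : (mu setT < +oo)%E.

(** The mean ergodic theorem supplies an orthogonal projection, so the choice made in [orth_proj]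
    never falls back on its default 0. *)
Lemma eigen_projP t f : normc t = 1 ->
  koopman T (eigen_proj T t f) = t *: eigen_proj T t f /\
  forall h, koopman T h = t *: h -> L2_inner (f - eigen_proj T t f) h = 0.
Proof.
move=> t1; have [g [Ug og _]] := mean_ergodic
  (U := koopman T) (@L2_inner_is_inner_product _ _ _ mu) (L2_complete mu_fin)
  koopman_isometry t1 f.
have [|] := @xgetPex _ 0 [set g | Defs.eigenspace T t g /\
  forall h, Defs.eigenspace T t h -> L2_inner (f - g) h = 0]; last by split.
by exists g; split.
Qed.

End koopman_isometry.

(** * Points of a rational spectrum *)

Section spectrum_roots.
Context (R : realType) (n : nat -> nat).
Hypothesis rational_n : rational_spectrum R n.

Lemma spectrum_root (t : spectrum R n) :
  normc (val t) = 1 /\ exists2 b, (0 < b)%N & val t ^+ b = 1.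
Proof. by apply: rational_circle_root; apply: rational_n; exact: set_valP. Qed.

(** Each point has a rational angle, and the rationals are countable. *)
Lemma spectrum_rank : exists rank : spectrum R n -> nat, injective rank.
Proof.
have /choice[q qP] (t : spectrum R n) :
    exists x : rat, expi (ratr x) = val t :> R[i].
  by have /rational_n[x _ xE] := set_valP t; exists x.
exists (fun t => choice.pickle (q t)) => s t /(pcan_inj choice.pickleK) qst.
by apply: val_inj; rewrite -!qP qst.
Qed.

(** A point of the circle outside [vanishing_products n] is one of the generators of the
    spectrum. *)
Lemma expi_spectrum_or_vanishing M (x : R) : (0 < M)%N ->
  (exists t : spectrum R n, val t = expi x) \/
  (ip_poly R n (index_iota M d)).[expi x] @[d --> \oo] --> (0 : R[i]).
Proof.
move=> M0; have [van|nvan] := pselect (vanishing_products n (expi x)).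
  right; have [_ lim0] := van M M0.
  (* The products in [vanishing_products] include the factor of index [d], whereas [index_iota M d]
     stops before it. *)
  rewrite -(@cvg_shiftS R[i]^o); apply: cvg_trans lim0.
  by apply: near_eq_cvg; apply: nearW => d /=; rewrite horner_ip_poly.
left; have xs : spectrum R n (expi x).
  by apply: sub_gen_smallest; split=> //; rewrite /unit_circle/= normrc normc_expi.
by exists (SigSub (mem_set xs)).
Qed.

(** The products over all intervals starting at [M] converge at a root of unity, so the subsequence
    that defines [omega] has the same limit, and [lim] there is a genuine limit. *)
Lemma omega_cvg (Phi : nat -> {fset nat}) M a (t : spectrum R n) :
  (forall N j, (j \in Phi N) = (M <= j <= a N)%N) -> a @ \oo --> \oo ->
  (ip_poly R n (index_iota M d)).[val t] @[d --> \oo] --> omega n Phi (val t).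
Proof.
move=> PhiE aoo; have [t1 [b b0 tb]] := spectrum_root t.
have /cvg_ex[w qw] := @ip_poly_root_cvg R n (val t) b M t1 b0 tb.
suff -> : omega n Phi (val t) = w by [].
apply: (@cvg_lim R[i]^o); first exact: norm_hausdorff.
have aS : (fun N => (a N).+1) @ \oo --> \oo by exact: cvg_comp aoo (cvg_addnl 1).
have := cvg_comp _ _ aS qw; apply: cvg_trans.
apply: near_eq_cvg; apply: nearW => N /=.
by rewrite horner_ip_poly (perm_big _ (folner_perm N PhiE)).
Qed.

End spectrum_roots.

Unset Implicit Arguments.

(** Strong operator convergence is pointwise convergence on [L2]. The sum over the spectrum is the
    limit of finite partial sums along [totally]; a common limit [S] expresses that both sides
    converge and agree. *)
Theorem corollary3p8 (R : realType) (d : measure_display)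
    (X : borelMetricType d R) (mu : probability X R) (T : invertible_mpt mu)
    (n : nat -> nat) (Phi : nat -> {fset nat}) :
  compact [set: X] -> regular_measure mu ->
  (forall j, (0 < j)%N -> (0 < n j)%N) ->
  rational_spectrum R n -> increasing_folner Phi ->
  exists S : L2 mu -> L2 mu,
    {ptws, partial_sum (fun t : spectrum R n =>
        omega n Phi (val t) *: eigen_proj T (val t)) @ totally --> S} /\
    {ptws, (fun N => ip_avg n (Phi N) (fun k : nat => iter k (koopman T)))
        @ \oo --> S}.
Proof.
move=> _ _ _ rat [M [a [M0 aoo PhiE]]].
have mu_fin : (mu setT < +oo)%E by rewrite probability_setT ltry.
have [rank rankI] := spectrum_rank rat.
have t1 (t : spectrum R n) : Normc.normc (val t) = 1 by case: (spectrum_root rat t).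
pose q d := ip_poly R n (index_iota M d).
have /choice[S SP] f : exists S : L2 mu,
    partial_sum (fun t : spectrum R n =>
      omega n Phi (val t) *: eigen_proj T (val t) f) @ totally --> S /\
    (fun d => act (koopman T) (q d) f) @ \oo --> S.
  apply: (@spectral_limit R _ (@L2_inner d X R mu) (koopman T)
    (@L2_inner_is_inner_product _ _ _ mu) (L2_complete mu_fin)
    (@koopman_isometry _ _ _ _ T) (spectrum R n) val rank val_inj t1 rankI
    (fun t => eigen_proj T (val t))).
  - by move=> t g; case: (eigen_projP T mu_fin g (t1 t)).
  - by move=> t g h; case: (eigen_projP T mu_fin g (t1 t)) => _; apply.
  - by move=> k z; exact: normc_ip_poly_le1.
  - by move=> k k' z z1; exact: normc_ip_poly_decr.
  - by move=> x; exact: expi_spectrum_or_vanishing.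
  - by move=> t; exact: (omega_cvg rat PhiE aoo).
have tF : ProperFilter (@totally (spectrum R n)) by exact: totally_filter.
exists S; split; apply/pointwise_cvgP => f; have [sumS actS] := SP f.
  rewrite -fmap_comp (_ : _ \o _ = partial_sum (fun t : spectrum R n =>
    omega n Phi (val t) *: eigen_proj T (val t) f)); first exact: sumS.
  by apply/funext => A; rewrite /partial_sum/= fct_sumE.
(* The set [Phi N] is the interval from [M] to [a N] inclusive, so its average is the action of [q]
   at index [(a N).+1], which tends to infinity. *)
rewrite -fmap_comp (_ : _ \o _ = (fun d => act (koopman T) (q d) f) \o
  (fun N => (a N).+1)).
  by apply: (cvg_comp _ _ _ actS); exact: cvg_comp aoo (cvg_addnl 1).
apply/funext => N /=; rewrite ip_avg_act /q /ip_poly; congr (act _ _ _).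
exact/perm_big/folner_perm.
Qed.
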